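(* Let $(M,g)$ be a non-compact, arithmetic, hyperbolic $3$-manifold. Then for every $\ell\in\mathcal{L}_p(M,g)$ and every $k\in\mathbb{N}$, there is a $k$-term arithmetic progression in $\mathcal{L}_p(M,g)$ each of whose terms is an integer multiple of $\ell$.
   Context: A hyperbolic $3$-manifold is $\mathbb{H}^3/\Gamma$ with the metric of constant curvature $-1$; it is arithmetic if $\Gamma$ is an arithmetic lattice in $\mathrm{Isom}(\mathbb{H}^3)$. (In the non-compact case this is equivalent to $M$ being commensurable with $\mathbb{H}^3/\mathrm{PSL}(2,\mathcal{O}_K)$ for some imaginary quadratic field $K$ with ring of integers $\mathcal{O}_K$, i.e. the two having a common finite Riemannian orbifold cover.) For a Riemannian manifold $(M,g)$ and a conjugacy class $[\gamma]$ in $\pi_1(M)$, let $L_{[\gamma]}$ be the set of lengths of all closed geodesics in $M$ representing $[\gamma]$ (possibly empty). A conjugacy class $[\gamma]$ is primitive if $\gamma$ is not a proper power of some other element of $\pi_1(M)$. The primitive length spectrum $\mathcal{L}_p(M,g)$ is the multiset union of the $L_{[\gamma]}$ over all primitive conjugacy classes. A multiset $S$ of real numbers contains a $k$-term arithmetic progression if it contains numbers $x_1<\cdots<x_k$ with $x_j=aj+b$ for some $a,b$ (constant progressions are not allowed). *)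

(* Defs.v *)
From HB Require Import structures.
From mathcomp Require Import all_boot all_order all_algebra.
From mathcomp Require Import generic_quotient complex.
From mathcomp Require Import all_classical all_reals all_analysis.
Set Implicit Arguments.
Unset Strict Implicit.
Unset Printing Implicit Defensive.
Import Order.TTheory GRing.Theory Num.Theory.
Import numFieldNormedType.Exports.
Local Open Scope classical_set_scope.
Local Open Scope ring_scope.
Local Open Scope quotient_scope.

(* Upper half-space model: [((x, y), t)] is the point x + i y + t j. The topology
   is the one induced by [R * R * R], which is also the topology of
   the hyperbolic metric. *)
Definition H3 (R : realType) : Type :=
  set_type [set p : R * R * R | 0 < p.2].

HB.instance Definition _ (R : realType) :=
  Topological.copy (H3 R) (set_type [set p : R * R * R | 0 < p.2]).

Definition zcoord (R : realType) (p : H3 R) : R[i] :=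
  ((set_val p).1.1 +i* (set_val p).1.2)%C.
Definition height (R : realType) (p : H3 R) : R := (set_val p).2.

Definition arcosh (R : realType) (x : R) : R := ln (x + Num.sqrt (x ^+ 2 - 1)).

(* The distance of the metric (|dz|^2 + dt^2) / t^2, of curvature -1. *)
Definition hdist (R : realType) (p q : H3 R) : R :=
  arcosh (1 + ((Normc.normc (zcoord p - zcoord q)) ^+ 2
               + (height p - height q) ^+ 2)
              / (2 * height p * height q)).

Record isom (R : realType) := Isom {
  isom_fun :> H3 R -> H3 R;
  isom_bij : bijective isom_fun;
  isom_dist : forall p q, hdist (isom_fun p) (isom_fun q) = hdist p q }.

HB.instance Definition _ (R : realType) := gen_eqMixin (isom R).
HB.instance Definition _ (R : realType) := gen_choiceMixin (isom R).

Section IsomGroup.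
Variable R : realType.
Implicit Types f g h : isom R.

Lemma isom_ext f g : (forall p, f p = g p) -> f = g.
Proof.
case: f g => [f bf df] [g bg dg] /= /funext fg; case: _ / fg bg dg => bg dg.
by rewrite (Prop_irrelevance bf bg) (Prop_irrelevance df dg).
Qed.

Definition isom_one : isom R :=
  @Isom R idfun (Bijective (fun=> erefl) (fun=> erefl)) (fun _ _ => erefl).

Definition isom_mul f g : isom R :=
  @Isom R (f \o g) (bij_comp (isom_bij f) (isom_bij g))
    (fun p q => etrans (isom_dist f (g p) (g q)) (isom_dist g p q)).

Lemma isom_inv_subproof f :
  exists g : isom R, cancel f g /\ cancel g f.
Proof.
case: (isom_bij f) => g fK gK.
have dg p q : hdist (g p) (g q) = hdist p q by rewrite -(isom_dist f) !gK.
by exists (Isom (Bijective gK fK) dg).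
Qed.

Definition isom_inv f : isom R := projT1 (cid (isom_inv_subproof f)).

Lemma isom_mulA : associative isom_mul. Proof. by move=> f g h; exact: isom_ext. Qed.
Lemma isom_mul1g : left_id isom_one isom_mul.
Proof. by move=> f; exact: isom_ext. Qed.
Lemma isom_mulg1 : right_id isom_one isom_mul.
Proof. by move=> f; exact: isom_ext. Qed.
Lemma isom_mulVg : left_inverse isom_one isom_inv isom_mul.
Proof.
move=> f; apply: isom_ext => p /=.
by rewrite /isom_inv; case: cid => g /= [fK _]; rewrite fK.
Qed.
Lemma isom_mulgV : right_inverse isom_one isom_inv isom_mul.
Proof.
move=> f; apply: isom_ext => p /=.
by rewrite /isom_inv; case: cid => g /= [_ gK]; rewrite gK.
Qed.

HB.instance Definition _ := isGroup.Build (isom R)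
  isom_mulA isom_mul1g isom_mulg1 isom_mulVg isom_mulgV.

End IsomGroup.

Section Quotient.
Variables (R : realType) (Gam : groupClosed (isom R)).

Definition orbit_rel : rel (H3 R) :=
  fun p q => `[< exists2 g, g \in Gam & isom_fun g p = q >].

Lemma orbit_refl : reflexive orbit_rel.
Proof. by move=> p; apply/asboolP; exists 1%g; rewrite // gpred1. Qed.

Lemma orbit_sym : symmetric orbit_rel.
Proof.
suff imp p q : orbit_rel p q -> orbit_rel q p.
  by move=> p q; apply/idP/idP; exact: imp.
move=> /asboolP[g gG <-]; apply/asboolP; exists (g^-1)%g; first by rewrite gpredV.
by have := congr1 (fun h : isom R => h p) (mulVg g).
Qed.

Lemma orbit_trans : transitive orbit_rel.
Proof.
move=> q p r /asboolP[g gG <-] /asboolP[h hG <-]; apply/asboolP.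
by exists (h * g)%g => //; rewrite gpredM.
Qed.

Canonical orbit_equiv := EquivRel orbit_rel orbit_refl orbit_sym orbit_trans.

Definition hmanifold := quotient_topology {eq_quot orbit_equiv}.

Definition hproj : H3 R -> hmanifold := fun p => \pi_hmanifold p.

(* [Gam] acts freely and properly discontinuously, i.e. H^3 / Gam is a
   manifold and H^3 -> H^3 / Gam is its (Riemannian) universal covering, with
   deck transformation group [Gam]. *)
Definition is_hyperbolic_manifold_group : Prop :=
  (forall (g : isom R) (p : H3 R), g \in Gam -> g p = p -> g = 1%g) /\
  (forall A : set (H3 R), compact A ->
     finite_set [set g : isom R | g \in Gam /\ (g @` A) `&` A !=set0]).

End Quotient.

Section Arithmetic.
Variable R : realType.

Definition finite_index (D G : {pred isom R}) : Prop :=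
  {subset D <= G} /\
  finite_set [set [set (g * h)%g | h in [set` D]] | g in [set` G]].

(* H^3 / D is a finite Riemannian orbifold cover of H^3 / G: such a covering
   map lifts to an isometry [f] of H^3 with f D f^-1 contained in G. *)
Definition finite_orbifold_cover (D G : {pred isom R}) : Prop :=
  exists f : isom R, finite_index [pred g | (g ^ f)%g \in D] G.

Definition commensurable (G1 G2 : {pred isom R}) : Prop :=
  exists D : groupClosed (isom R),
    finite_orbifold_cover D G1 /\ finite_orbifold_cover D G2.

(* The imaginary quadratic field Q(sqrt(-d)), d > 0, as a subset of C. *)
Definition imag_quadratic_field (d : nat) : set R[i] :=
  [set z | exists a b : rat,
     z = ratr a + ratr b * (0 +i* Num.sqrt d%:R)%C].

Definition ring_of_integers (K : set R[i]) : set R[i] :=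
  [set z | K z /\ integralOver (intr : int -> R[i]) z].

(* The Poincare extension to H^3 of z |-> (a z + b) / (c z + d) when
   a d - b c = 1. *)
Definition poincare_extension (a b c d : R[i]) (g : isom R) : Prop :=
  forall p : H3 R,
    let z := zcoord p in let t := height p in
    let N := Normc.normc (c * z + d) ^+ 2 + Normc.normc c ^+ 2 * t ^+ 2 in
    zcoord (g p) = ((a * z + b) * ((c * z + d)^*)%C
                    + a * (c^*)%C * (t ^+ 2)%:C%C) / (N%:C)%C /\
    height (g p) = t / N.

Definition PSL2 (A : set R[i]) : {pred isom R} :=
  [pred g | `[< exists a b c d : R[i],
     [/\ A a, A b, A c & A d] /\ a * d - b * c = 1 /\
     poincare_extension a b c d g >] ].

(* A non-compact H^3 / Gam is arithmetic when it is commensurable with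
   H^3 / PSL(2, O_K) for some imaginary quadratic field K; arithmeticity of
   compact quotients is a different condition, not defined here. *)
Definition noncompact_arithmetic (Gam : groupClosed (isom R)) : Prop :=
  ~ compact [set: hmanifold Gam] /\
  exists2 d : nat, (0 < d)%N &
    commensurable Gam (PSL2 (ring_of_integers (imag_quadratic_field d))).

End Arithmetic.

Section Spectrum.
Variables (R : realType) (Gam : groupClosed (isom R)).

Definition geodesic_line (c : R -> H3 R) : Prop :=
  forall s t, hdist (c s) (c t) = `|s - t|.

(* The unit speed geodesics of M are the projections of those of H^3. *)
Definition geodesic_lift (c : R -> hmanifold Gam) (c' : R -> H3 R) : Prop :=
  geodesic_line c' /\ forall t, c t = hproj Gam (c' t).

Definition closed_geodesic (c : R -> hmanifold Gam) (l : R) : Prop :=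
  [/\ 0 < l, exists c', geodesic_lift c c' & forall t, c (t + l) = c t].

Definition conj_class (g : isom R) : set (isom R) :=
  [set (g ^ h)%g | h in [set h | h \in Gam]].

(* Conjugacy classes of pi_1(M) = Gam are free homotopy classes of loops; that
   of a closed geodesic is given by the deck transformation translating a
   lift by one period. *)
Definition represents (c : R -> hmanifold Gam) (l : R) (C : set (isom R)) :
  Prop :=
  exists2 c', geodesic_lift c c' & exists2 g, C g & forall t, c' (t + l) = g (c' t).

Definition class_lengths (C : set (isom R)) : set R :=
  [set l | exists2 c, closed_geodesic c l & represents c l C].

Definition primitive_elt (g : isom R) : Prop :=
  g \in Gam /\
  ~ exists h n, [/\ h \in Gam, h != g, (1 < n)%N & g = (h ^+ n)%g].

Definition primitive_class (C : set (isom R)) : Prop :=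
  exists2 g, primitive_elt g & C = conj_class g.

(* The multiset union of the [class_lengths C] is encoded as a disjoint union:
   the multiplicity of [l] is the number of [C] with [(C, l)] in the set. *)
Definition primitive_length_spectrum : set (set (isom R) * R) :=
  [set Cl | primitive_class Cl.1 /\ class_lengths Cl.1 Cl.2].

End Spectrum.

Definition in_multiset (I : Type) (R : realType) (S : set (I * R)) (x : R) :
  Prop := exists i, S (i, x).

(* As the terms are distinct, multiplicities play no role in containment. *)
Definition arithmetic_progression_in (I : Type) (R : realType)
    (S : set (I * R)) (k : nat) (x : 'I_k -> R) : Prop :=
  [/\ forall i j : 'I_k, (i < j)%N -> x i < x j,
      exists a b : R, forall j : 'I_k, x j = a * j.+1%:R + b
    & forall j : 'I_k, in_multiset S (x j)].

(* Main.v *)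
(** Let [g] in [Gam] translate a geodesic by [l].  A power of [g] is conjugate
    to an element of [PSL2 O] with some matrix [M], and conjugacy in [SL2(C)] is
    decided by the trace.  Some finite-index subgroup of [PSL2 O] conjugate into
    [Gam] contains the products [[1, x; 0, 1] [1, 0; N, 1]], [x] in [N O], for a
    suitable [N]; these realise every trace congruent to 2 modulo [N^2 O], hence
    that of [M^(n0 q)] for all [q], since the traces of the powers of [M] are
    periodic modulo [N^2].  So [Gam] contains, for every [q], an element [eta_q] of
    length [q K l] with lower-left entry [N] independent of [q].

    The lower-left entry of an [s]-th power [E^s] of an element of [PSL2 O] is that
    of [E] times a Chebyshev polynomial in the trace of [E], and for [s > 1] the
    modulus of the latter is unbounded as the length of [E^s] grows: for large [q]
    it exceeds [N].  So the image of [eta_q] has no proper root in [PSL2 O], a root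
    of [eta_q] in [Gam] has exponent bounded by the index, and taking the largest
    exponent [s_q] gives a primitive element of length [q K l / s_q], with [s_q]
    bounded.  Van der Waerden's theorem applied to the colouring [q |-> s_q]
    concludes. *)
Require Import Defs.
From mathcomp Require Import all_boot all_order all_algebra.
From mathcomp Require Import algC algnum complex.
From mathcomp Require Import all_classical all_reals all_analysis.
From mathcomp Require Import ring lra zify.
Set Implicit Arguments.
Unset Strict Implicit.
Unset Printing Implicit Defensive.
Import Order.TTheory GRing.Theory Num.Theory.

(** * Van der Waerden's theorem on arithmetic progressions *)

(* Colour focusing: either there is a progression of length [k + 2], or there are
   [s] progressions of length [k + 1], with distinct colours, whose continuations
   to the left all meet in [F]. *)
Lemma van_der_Waerden_focusing (k : nat) :
  (forall C : finType, exists W, forall f : nat -> C, exists a d,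
     [/\ 0 < d, a + k.+1 * d < W &
         forall j, 0 < j <= k.+1 -> f (a + j * d) = f (a + d)]) ->
  forall (C : finType) (s : nat), exists W, forall f : nat -> C,
    (exists a d, [/\ 0 < d, a + k.+1 * d < W &
       forall j, j <= k.+1 -> f (a + j * d) = f a]) \/
    (exists F D, [/\ size D = s, uniq [seq f (F + d) | d <- D], F < W &
       forall d, d \in D -> [/\ 0 < d, F + k.+1 * d < W &
         forall j, 0 < j <= k.+1 -> f (F + j * d) = f (F + d)]]).
Proof.
move=> IH C; elim=> [|s [W HW]]; first by exists 1 => f; right; exists 0, [::].
(* Cut the integers into blocks of length [W]: the colouring of a block is one colour in a larger
   finite type, to which [IH] applies. *)
have [N HN] := IH {ffun 'I_W -> C}.
exists (N * W) => f.
have [b [e [e0 beN Hbe]]] := HN (fun n => [ffun i : 'I_W => f (n * W + i)]).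
have blk j i : 0 < j <= k.+1 -> i < W ->
    f ((b + j * e) * W + i) = f ((b + e) * W + i).
  by move=> jk iW; move/ffunP: (Hbe _ jk) => /(_ (Ordinal iW)); rewrite !ffunE.
have leNW j i : j <= k.+1 -> i < W -> (b + j * e) * W + i < N * W.
  move=> jk iW; apply: (@leq_trans ((b + j * e).+1 * W)); first by rewrite mulSn; lia.
  by rewrite leq_mul2r; apply/orP; right; nia.
have [[a [d [d0 adW Had]]]|[F [D [sD uD FW HD]]]] :=
  HW (fun n => f ((b + e) * W + n)).
  left; exists ((b + e) * W + a), d; split => //.
    by rewrite -addnA -{1}(mul1n e); apply: leNW.
  by move=> j jk; rewrite -addnA Had.
(* A focus that shares the colour of one of its progressions prolongs it; otherwise it contributes a
   new colour. *)
have [Fin|Fnin] := boolP (f ((b + e) * W + F) \in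
                          [seq f ((b + e) * W + (F + d)) | d <- D]).
  left; have /mapP[d dD fFd] := Fin; have [d0 FdW Hd] := HD d dD.
  exists ((b + e) * W + F), d; split => //.
    by rewrite -addnA -{1}(mul1n e); apply: leNW.
  move=> [|j] jk; first by rewrite addn0.
  by rewrite -addnA Hd // fFd.
(* The focus moves to the same position in block [b]. Copies of the old focus in the later blocks
   form the new progression, of difference [e * W], and every old difference grows by [e * W]. *)
right; exists (b * W + F), (e * W :: [seq e * W + d | d <- D]); split.
- by rewrite /= size_map sD.
- rewrite /= -map_comp.
  have -> : map ((fun d => f (b * W + F + d)) \o addn (e * W)) D =
            [seq f ((b + e) * W + (F + d)) | d <- D].
    by apply/eq_map => d /=; congr f; nia.
  have -> : b * W + F + e * W = (b + e) * W + F by nia.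
  by rewrite Fnin.
- by rewrite -{1}(addn0 b) -(mul0n e); apply: leNW.
have base : 0 < e * W by rewrite muln_gt0 e0; case: (W) FW.
move=> d; rewrite inE => /orP[/eqP-> | /mapP[{}d dD ->]].
  split=> //.
    by have := @leNW k.+1 F (leqnn _) FW; nia.
  move=> j jk; have -> : b * W + F + j * (e * W) = (b + j * e) * W + F by nia.
  by rewrite blk //; congr f; nia.
have [d0 FdW Hd] := HD d dD; split; first by lia.
  by have := @leNW k.+1 (F + k.+1 * d) (leqnn _) FdW; nia.
move=> j jk.
have -> : b * W + F + j * (e * W + d) = (b + j * e) * W + (F + j * d) by nia.
rewrite blk //; last by nia.
by rewrite Hd //; congr f; nia.
Qed.

(* The base point [a] may have another colour: it is the focus at the next step. *)
Lemma van_der_Waerden (k : nat) (C : finType) :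
  exists W, forall f : nat -> C, exists a d,
    [/\ 0 < d, a + k * d < W &
        forall j, 0 < j <= k -> f (a + j * d) = f (a + d)].
Proof.
elim: k C => [|[|k] IH] C.
- by exists 1 => f; exists 0, 1; split=> // -[].
- by exists 2 => f; exists 0, 1; split=> // j /andP[? ?]; have -> : j = 1 by lia.
have [W HW] := van_der_Waerden_focusing IH C #|C|.+1.
(* Shifting the colouring by [W] leaves room for the base point [W + a - d], one step to the left of
   the progression. *)
exists (W + W) => f.
have [[a [d [d0 adW Had]]]|[F [D [sD uD _ _]]]] := HW (fun n => f (W + n)).
  exists (W + a - d), d; split=> //; first by nia.
  move=> [//|j] jk; have -> : W + a - d + j.+1 * d = W + (a + j * d) by nia.
  by rewrite Had //; congr f; nia.
have := max_card [in [seq f (W + (F + d)) | d <- D]].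
by rewrite (card_uniqP uD) size_map sD ltnn.
Qed.

Local Open Scope ring_scope.
Local Open Scope complex_scope.

#[local] Arguments zcoord : simpl never.
#[local] Arguments height : simpl never.
#[local] Arguments conjc : simpl never.

Local Notation nsq z := (Normc.normc z ^+ 2).

(** * Poincare extensions *)

Section Geometry.
Variable R : realType.
Implicit Types (a b c d z w : R[i]) (p q : H3 R) (g h : isom R).

Lemma real_complexM (x y : R) : (x * y)%:C = x%:C * y%:C.
Proof. exact: rmorphM. Qed.
Lemma real_complexD (x y : R) : (x + y)%:C = x%:C + y%:C.
Proof. exact: rmorphD. Qed.
Lemma real_complexN (x : R) : (- x)%:C = - x%:C.
Proof. exact: rmorphN. Qed.
Lemma real_complexV (x : R) : (x^-1)%:C = (x%:C)^-1.
Proof. exact: fmorphV. Qed.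
Lemma real_complexX (x : R) n : (x ^+ n)%:C = x%:C ^+ n.
Proof. exact: rmorphXn. Qed.
Lemma real_complex_nat n : (n%:R : R)%:C = n%:R.
Proof. exact: rmorph_nat. Qed.
Definition rcE := (real_complex_nat, real_complexX, real_complexV,
  real_complexN, real_complexD, real_complexM).

Lemma conjcM z w : conjc (z * w) = conjc z * conjc w.
Proof. exact: rmorphM. Qed.
Lemma conjcD z w : conjc (z + w) = conjc z + conjc w.
Proof. exact: rmorphD. Qed.
Lemma conjcN z : conjc (- z) = - conjc z.
Proof. exact: rmorphN. Qed.
Lemma conjcX z n : conjc (z ^+ n) = conjc z ^+ n.
Proof. exact: rmorphXn. Qed.
Definition cjE := (conjcN, conjcD, conjcX, conjcM, conjc_inv, conjc_nat, conjcK, conjc_real).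

Lemma sqr_normcE z : (nsq z)%:C = z * conjc z.
Proof. by rewrite -sqr_normc rmorphXn. Qed.

Lemma normc_ge0 z : 0 <= Normc.normc z.
Proof. by case: z => a b; exact: sqrtr_ge0. Qed.

Lemma height_gt0 p : 0 < height p.
Proof. by have := set_valP p. Qed.

Lemma heightC_neq0 p : (height p)%:C != 0 :> R[i].
Proof. by rewrite (inj_eq (@complexI R) _ 0) gt_eqF ?height_gt0. Qed.

Lemma H3_eq p q : zcoord p = zcoord q -> height p = height q -> p = q.
Proof.
move=> zpq tpq; suff: set_val p = set_val q by move=> /val_inj.
move: zpq tpq; rewrite /zcoord /height.
by move: (set_val p) (set_val q) => [[a b] t] [[a' b'] t'] /= [-> ->] ->.
Qed.

Lemma H3_exists z (t : R) : 0 < t -> exists2 p, zcoord p = z & height p = t.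
Proof.
case: z => x y t0; have mt : (x, y, t) \in [set p : R * R * R | 0 < p.2]%classic.
  by rewrite inE.
by exists (SigSub mt).
Qed.

(** The denominator of [poincare_extension], kept in [R[i]]: with each conjugate generalised to an
    independent variable, identities between extensions become rational identities for [field]. *)
Definition denomC c d z (t : R) : R[i] :=
  (c * z + d) * conjc (c * z + d) + c * conjc c * t%:C ^+ 2.

Lemma denomCE c d z (t : R) :
  denomC c d z t =
  (nsq (c * z + d) + nsq c * t ^+ 2)%:C.
Proof. by rewrite /denomC !rcE -!sqr_normcE !rcE. Qed.

Lemma denom_gt0 a b c d z (t : R) : a * d - b * c = 1 -> 0 < t ->
  0 < nsq (c * z + d) + nsq c * t ^+ 2.
Proof.
move=> det1 t0; have [c0|c0] := eqVneq c 0.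
  rewrite c0 mul0r add0r Normc.normc0 expr0n mul0r addr0 exprn_gt0 //.
  rewrite lt0r normc_ge0 andbT; apply/eqP => /Normc.eq0_normc d0.
  by move: det1; rewrite c0 d0 !mulr0 subrr => /esym/eqP; rewrite oner_eq0.
rewrite ltr_wpDl ?sqr_ge0 // mulr_gt0 ?exprn_gt0 //.
by rewrite lt0r normc_ge0 andbT; apply/eqP => /Normc.eq0_normc /eqP; rewrite (negPf c0).
Qed.

Lemma denomC_neq0 a b c d p : a * d - b * c = 1 ->
  denomC c d (zcoord p) (height p) != 0.
Proof.
move=> det1; rewrite denomCE (inj_eq (@complexI R) _ 0) gt_eqF //.
exact: (denom_gt0 _ det1 (height_gt0 p)).
Qed.

Definition poincareC a b c d (f : H3 R -> H3 R) := forall p,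
  let z := zcoord p in let t := height p in
  zcoord (f p) = ((a * z + b) * conjc (c * z + d) + a * conjc c * t%:C ^+ 2)
                 / denomC c d z t /\
  (height (f p))%:C = t%:C / denomC c d z t.

Lemma poincareE a b c d g :
  poincare_extension a b c d g <-> poincareC a b c d g.
Proof.
split=> H p; have [] := H p.
  by move=> /= -> ->; rewrite denomCE !rcE; split.
move=> zE tE; rewrite /= zE denomCE !rcE; split=> //; apply: complexI.
by rewrite tE denomCE !rcE.
Qed.

(* [cosh (hdist p q) - 1] *)
Definition cdist p q : R :=
  (nsq (zcoord p - zcoord q) + (height p - height q) ^+ 2)
   / (2 * height p * height q).

Lemma cdistC p q : (cdist p q)%:C =
  ((zcoord p - zcoord q) * conjc (zcoord p - zcoord q)
   + ((height p)%:C - (height q)%:C) ^+ 2) / (2 * (height p)%:C * (height q)%:C).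
Proof. by rewrite /cdist -sqr_normcE !rcE. Qed.

Lemma poincare_cdist a b c d (f : H3 R -> H3 R) : a * d - b * c = 1 ->
  poincareC a b c d f -> forall p q, cdist (f p) (f q) = cdist p q.
Proof.
move=> det1 H p q; apply: complexI; rewrite !cdistC.
have [/= -> ->] := H p; have [/= -> ->] := H q.
have := denomC_neq0 p det1; have := denomC_neq0 q det1.
have := heightC_neq0 p; have := heightC_neq0 q.
move: (zcoord p) (zcoord q) => z w; set t := (height p)%:C; set s := (height q)%:C.
rewrite /denomC !cjE -/t -/s => s0 t0 n2 n1.
have det1' : conjc a * conjc d - conjc b * conjc c = 1.
  by rewrite -!conjcM -conjcN -conjcD det1 conjc1.
(* The formula for the height omits a factor [|ad - bc|]; restoring it makes the
   identity hold without using that the determinant is 1. *)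
set delta := (a * d - b * c) * (conjc a * conjc d - conjc b * conjc c).
have delta1 : delta = 1 by rewrite /delta det1 det1' mul1r.
have key u v x : (u + v) / x = (u + delta * v) / x by rewrite delta1 mul1r.
transitivity (delta * (((z - w) * (conjc z - conjc w) + (t - s) ^+ 2) / (2 * t * s)));
  last by rewrite delta1 mul1r.
rewrite key /delta {key delta delta1 det1 det1'}.
move: n1 n2 s0 t0; move: (conjc a) (conjc b) (conjc c) (conjc d) (conjc z) (conjc w).
move: t s => t s A B C D Z W n1 n2 s0 t0.
rewrite (mulrC (C * Z + D)) (mulrC (C * W + D)) (mulrC C c).
field.
by rewrite s0 t0 n1 n2.
Qed.

Lemma poincareC_comp a b c d a' b' c' d' (f g : H3 R -> H3 R) :
  a' * d' - b' * c' = 1 ->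
  poincareC a b c d f -> poincareC a' b' c' d' g ->
  poincareC (a * a' + b * c') (a * b' + b * d')
            (c * a' + d * c') (c * b' + d * d') (f \o g).
Proof.
move=> det1 Hf Hg p; have [/= -> ->] := Hf (g p); have [/= z1E t1E] := Hg p.
have := denomC_neq0 p det1; have t0 := heightC_neq0 p.
move: z1E t1E t0; rewrite /denomC => -> ->.
move: (zcoord p) => z; move: ((height p)%:C) (conjc_real (height p)) => t tr t0.
rewrite !cjE tr => n0.
have det1' : conjc a' * conjc d' - conjc b' * conjc c' = 1.
  by rewrite -!conjcM -conjcN -conjcD det1 conjc1.
(* As in [poincare_cdist], the height of [g p] omits a factor [|a'd' - b'c'|]; its square [delta]
   has to be restored for a polynomial identity. *)
set delta := (a' * d' - b' * c') * (conjc a' * conjc d' - conjc b' * conjc c').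
have delta1 : delta = 1 by rewrite /delta det1 det1' mul1r.
have key x : (t / x) ^+ 2 = delta * (t / x) ^+ 2 by rewrite delta1 mul1r.
rewrite key /delta {key delta delta1 det1 det1'}.
move: n0; move: (conjc a) (conjc b) (conjc c) (conjc d) (conjc z).
move: (conjc a') (conjc b') (conjc c') (conjc d').
move=> A' B' C' D' A B C D Z n0.
rewrite (mulrC (C' * Z + D')) (mulrC C' c').
set N := (c' * z + d') * (C' * Z + D') + c' * C' * t ^+ 2 in n0 *.
have divN (u v : R[i]) : u / N / (v / N) = u / v.
  by rewrite invf_div mulrA divfK.
set E := (X in _ / X = _ / _ /\ _); set E' := (X in _ = _ / X /\ _).
have EE : E = E' / N by rewrite /E /E' /N; field.
rewrite -/E -/E' EE divN; split=> //; set F := (X in X / (_ / _) = _).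
set F' := (X in _ = X / E').
have -> : F = F' / N by rewrite /F /F' /N; field.
exact: divN.
Qed.

Lemma poincareC_id : poincareC 1 0 0 1 id.
Proof.
move=> p; rewrite /denomC mul0r add0r conjc0 conjc1.
by rewrite !(mulr0, mul0r, mulr1, mul1r, addr0, divr1).
Qed.

Lemma poincareC_uniq a b c d (f g : H3 R -> H3 R) :
  poincareC a b c d f -> poincareC a b c d g -> f =1 g.
Proof.
move=> Hf Hg p; have [zf tf] := Hf p; have [zg tg] := Hg p.
by apply: H3_eq; [rewrite zf zg | apply: complexI; rewrite tf tg].
Qed.

Lemma poincareC_exists a b c d : a * d - b * c = 1 ->
  exists f : H3 R -> H3 R, poincareC a b c d f.
Proof.
move=> det1; suff /choice[f Hf] : forall p, exists q,
    let z := zcoord p in let t := height p in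
    zcoord q = ((a * z + b) * conjc (c * z + d) + a * conjc c * t%:C ^+ 2)
               / denomC c d z t /\ (height q)%:C = t%:C / denomC c d z t.
  by exists f.
move=> p; have N0 := denom_gt0 (zcoord p) det1 (height_gt0 p).
have [q zq tq] := H3_exists
  (((a * zcoord p + b) * conjc (c * zcoord p + d)
    + a * conjc c * (height p)%:C ^+ 2) / denomC c d (zcoord p) (height p))
  (divr_gt0 (height_gt0 p) N0).
by exists q; rewrite /= zq tq denomCE !rcE.
Qed.

Lemma hdistE p q : hdist p q = arcosh (1 + cdist p q).
Proof. by []. Qed.

Lemma poincare_exists a b c d : a * d - b * c = 1 ->
  exists g : isom R, poincare_extension a b c d g.
Proof.
move=> det1; have [f Hf] := poincareC_exists det1.
have det1' : d * a - - b * - c = 1 by rewrite mulrNN mulrC.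
have [g Hg] := poincareC_exists det1'.
have fK : cancel f g.
  apply: (poincareC_uniq (poincareC_comp det1 Hg Hf)).
  have -> : d * a + - b * c = 1 by rewrite -det1; ring.
  have -> : d * b + - b * d = 0 by ring.
  have -> : - c * a + a * c = 0 by ring.
  have -> : - c * b + a * d = 1 by rewrite -det1; ring.
  exact: poincareC_id.
have gK : cancel g f.
  apply: (poincareC_uniq (poincareC_comp det1' Hf Hg)).
  have -> : a * d + b * - c = 1 by rewrite -det1; ring.
  have -> : a * - b + b * a = 0 by ring.
  have -> : c * d + d * - c = 0 by ring.
  have -> : c * - b + d * a = 1 by rewrite -det1; ring.
  exact: poincareC_id.
have df p q : hdist (f p) (f q) = hdist p q.
  by rewrite !hdistE (poincare_cdist det1 Hf).
by exists (Isom (Bijective fK gK) df); apply/poincareE.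
Qed.

Lemma poincare_comp a b c d a' b' c' d' g h :
  a' * d' - b' * c' = 1 ->
  poincare_extension a b c d g -> poincare_extension a' b' c' d' h ->
  poincare_extension (a * a' + b * c') (a * b' + b * d')
                     (c * a' + d * c') (c * b' + d * d') (g * h)%g.
Proof.
move=> det1 /poincareE Hg /poincareE Hh.
exact/poincareE/poincareC_comp.
Qed.

Lemma poincare_id : poincare_extension 1 0 0 1 (1%g : isom R).
Proof. exact/poincareE/poincareC_id. Qed.

Lemma poincare_uniq a b c d g h :
  poincare_extension a b c d g -> poincare_extension a b c d h -> g = h.
Proof.
move=> /poincareE Hg /poincareE Hh.
exact/isom_ext/(poincareC_uniq Hg Hh).
Qed.

End Geometry.

(** * Translation lengths *)

Section Translations.
Variable R : realType.
Implicit Types (a b c d z w mu : R[i]) (p q : H3 R) (g h : isom R) (x y L : R).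

(** Twice the hyperbolic cosine; without the factor 1/2 it matches sums such as
    [nsq mu + (nsq mu)^-1]. *)
Definition cosh2 x : R := expR x + expR (- x).

Lemma cosh2_double x : cosh2 (x + x) = cosh2 x ^+ 2 - 2.
Proof.
rewrite /cosh2 opprD !expRD.
have e : expR x * expR (- x) = 1 by rewrite -expRD subrr expR0.
have -> : (2 : R) = 2 * (expR x * expR (- x)) by rewrite e mulr1.
by ring.
Qed.

(** With [u = expR x] and [v = expR y], the equation factors as [(u - v) (u v - 1) = 0], and
    [u v = 1] with [u, v >= 1] forces [u = v]. *)
Lemma cosh2_inj x y : 0 <= x -> 0 <= y -> cosh2 x = cosh2 y -> x = y.
Proof.
move=> x0 y0; rewrite /cosh2 => e.
have ex : expR x * expR (- x) = 1 by rewrite -expRD subrr expR0.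
have ey : expR y * expR (- y) = 1 by rewrite -expRD subrr expR0.
have ex1 : 1 <= expR x by rewrite -expR0 ler_expR.
have ey1 : 1 <= expR y by rewrite -expR0 ler_expR.
apply: expR_inj; have [//|ne] := eqVneq (expR x) (expR y).
have : (expR x - expR y) * (expR x * expR y - 1) = 0.
  have -> : (expR x - expR y) * (expR x * expR y - 1) =
    expR x * expR y * ((expR x + expR (-x)) - (expR y + expR (-y)))
    - expR y * (expR x * expR (-x) - 1) + expR x * (expR y * expR (-y) - 1).
    by ring.
  by rewrite e ex ey !subrr !mulr0 subrr addr0.
move/eqP; rewrite mulf_eq0 subr_eq0 (negPf ne) /= subr_eq0 => /eqP exy.
by apply/eqP; rewrite eq_le; apply/andP; split; nra.
Qed.

Lemma cdist_ge0 p q : 0 <= cdist p q.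
Proof.
rewrite /cdist divr_ge0 ?addr_ge0 ?sqr_ge0 //.
by rewrite !mulr_ge0 ?ltW ?height_gt0.
Qed.

Lemma arcosh_ge0 x : 1 <= x -> 0 <= arcosh x.
Proof.
by move=> x1; rewrite /arcosh ln_ge0 // ler_wpDr ?sqrtr_ge0.
Qed.

Lemma cosh2_arcosh x : 1 <= x -> cosh2 (arcosh x) = 2 * x.
Proof.
move=> x1; rewrite /cosh2 /arcosh.
have s0 : 0 <= Num.sqrt (x ^+ 2 - 1) by rewrite sqrtr_ge0.
have s2 : Num.sqrt (x ^+ 2 - 1) ^+ 2 = x ^+ 2 - 1 by rewrite sqr_sqrtr //; nra.
move: (Num.sqrt _) s0 s2 => s s0 s2.
have xs : 0 < x + s by lra.
rewrite expRN lnK ?posrE //.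
have -> : (x + s)^-1 = x - s.
  by apply: (mulfI (lt0r_neq0 xs)); rewrite divff ?lt0r_neq0 // mulrC -subr_sqr s2; ring.
by ring.
Qed.

Lemma hdist_ge0 p q : 0 <= hdist p q.
Proof. by rewrite hdistE arcosh_ge0 // lerDl cdist_ge0. Qed.

Lemma cosh2_hdist p q : cosh2 (hdist p q) = 2 * (1 + cdist p q).
Proof. by rewrite hdistE cosh2_arcosh // lerDl cdist_ge0. Qed.

Definition translates g L := 0 < L /\
  exists2 ga : R -> H3 R, geodesic_line ga & forall t, ga (t + L) = g (ga t).

(** Replaces the translated line by two distance equations at one of its points, which matrix
    entries can express. *)
Lemma translates_hdist g L (ga : R -> H3 R) t : 0 < L -> geodesic_line ga ->
  (forall t, ga (t + L) = g (ga t)) ->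
  hdist (ga t) (g (ga t)) = L /\ hdist (ga t) (g (g (ga t))) = L + L.
Proof.
move=> L0 gga tr; rewrite -!tr !gga; split.
  by rewrite opprD addrA subrr add0r normrN gtr0_norm.
by rewrite !opprD !addrA subrr add0r -opprD normrN gtr0_norm ?addr_gt0.
Qed.

Lemma translatesX g L n : (0 < n)%N -> translates g L -> translates (g ^+ n)%g (n%:R * L).
Proof.
move=> n0 [L0 [ga gc tr]]; split; first by rewrite mulr_gt0 // ltr0n.
exists ga => // t; elim: n {n0} t => [|n IH] t; first by rewrite mul0r addr0 expg0.
by rewrite expgSr /= -tr -IH; congr ga; rewrite -natr1; ring.
Qed.

Lemma translatesJ g h L : translates g L -> translates (g ^ h)%g L.
Proof.
move=> [L0 [ga gc tr]]; split => //; exists (fun t => (h^-1)%g (ga t)).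
  by move=> s t; rewrite isom_dist gc.
move=> t; rewrite tr.
by have /(congr1 (fun f : isom R => f (ga t))) := mulgV h => /= ->.
Qed.

End Translations.

(** * Translation length bounded by the trace *)

Section Loxodromic.
Variable R : realType.
Implicit Types (a b c d z w mu : R[i]) (p q : H3 R) (g h : isom R) (L : R).

Lemma nsqE (x y : R) : nsq (x +i* y) = x ^+ 2 + y ^+ 2.
Proof. by rewrite /= sqr_sqrtr // addr_ge0 ?sqr_ge0. Qed.

Lemma nsqM z w : nsq (z * w) = nsq z * nsq w.
Proof. by rewrite Normc.normcM exprMn. Qed.

Lemma nsqV z : nsq z^-1 = (nsq z)^-1.
Proof. by rewrite Normc.normcV exprVn. Qed.

Lemma nsq_eq0 z : (nsq z == 0) = (z == 0).
Proof.
rewrite sqrf_eq0; apply/eqP/eqP => [/Normc.eq0_normc //|->].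
exact: Normc.normc0.
Qed.

Lemma cdist_center a b c d g p : a * d - b * c = 1 ->
  poincare_extension a b c d g -> zcoord p = 0 -> height p = 1 ->
  2 * (1 + cdist p (g p)) = nsq a + nsq b + nsq c + nsq d.
Proof.
move=> det1 /poincareE Hg zp tp; apply: complexI.
move: (cdistC p (g p)); move: (cdist _ _) => X XE.
rewrite real_complexM !real_complexD !sqr_normcE XE {X XE}.
have [/= -> ->] := Hg p; have := denomC_neq0 p det1.
rewrite zp tp /denomC !mulr0 !add0r !cjE.
have -> : (1 : R)%:C = 1 by [].
have det1' : conjc a * conjc d - conjc b * conjc c = 1.
  by rewrite -!conjcM -conjcN -conjcD det1 conjc1.
rewrite (mulrC (conjc d) d) (mulrC (conjc c) c) expr1n !mulr1.
set N := d * conjc d + _ => N0; apply/eqP; rewrite -subr_eq0; apply/eqP.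
(* The two sides differ by [(1 - |ad - bc|^2) / N], where [N = |c|^2 + |d|^2] is the denominator at
   the centre. *)
transitivity ((1 - (a * d - b * c) * (conjc a * conjc d - conjc b * conjc c)) / N);
  last by rewrite det1 det1' mul1r subrr mul0r.
rewrite /N in N0 *; clear -N0.
move: N0; move: (conjc a) (conjc b) (conjc c) (conjc d) => A B C D N0.
by field; rewrite N0 ?oner_eq0 ?pnatr_eq0.
Qed.

(** Upper triangular matrices act transitively: with [s] the square root of the height,
    [[s, z/s; 0, 1/s]] carries [(0, 1)] to [(z, s^2)]. *)
Lemma conj_to_center p : exists a d b (P : isom R) (p0 : H3 R),
  [/\ a * d = 1, poincare_extension a b 0 d P, zcoord p0 = 0, height p0 = 1 & P p0 = p].
Proof.
have h0 := height_gt0 p; pose s := Num.sqrt (height p).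
have s0 : s != 0 by rewrite sqrtr_eq0 -ltNge.
have s2 : s ^+ 2 = height p by rewrite sqr_sqrtr // ltW.
have sC0 : s%:C != 0 :> R[i] by rewrite (inj_eq (@complexI R) _ 0).
exists s%:C, s%:C^-1, (zcoord p / s%:C).
have det1 : s%:C * s%:C^-1 - zcoord p / s%:C * 0 = 1.
  by rewrite mulr0 subr0 divff.
have [P HP] := poincare_exists det1.
have [p0 z0 t0] := @H3_exists R 0 1 ltr01.
exists P, p0; split=> //; first by rewrite divff.
have [] := (poincareE _ _ _ _ P).1 HP p0; rewrite /= z0 t0 /denomC.
rewrite !(mulr0, mul0r, addr0, add0r) conjc_inv conjc_real => zP tP.
apply: H3_eq.
  by rewrite zP conjc0 mulr0 mul0r addr0; field.
apply: complexI; rewrite tP -s2 real_complexX.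
by have -> : (1 : R)%:C = 1 by []; field.
Qed.

Lemma isomJE g h p : h ((g ^ h)%g p) = g (h p).
Proof. by have /(congr1 (fun f : isom R => f (g (h p)))) := mulgV h. Qed.

Lemma poincareV a b c d g : a * d - b * c = 1 ->
  poincare_extension a b c d g -> poincare_extension d (- b) (- c) a g^-1%g.
Proof.
move=> det1 Hg; have det1' : d * a - - b * - c = 1 by rewrite mulrNN mulrC.
have [h Hh] := poincare_exists det1'; suff -> : (g^-1)%g = h by [].
apply: mulg1_eq; apply: (@poincare_uniq _ 1 0 0 1); last exact: poincare_id.
have := poincare_comp det1' Hg Hh.
have -> : a * d + b * - c = 1 by rewrite -det1; ring.
have -> : a * - b + b * a = 0 by ring.
have -> : c * d + d * - c = 0 by ring.
by have -> : c * - b + d * a = 1 by rewrite -det1; ring.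
Qed.

Lemma det1M a b c d a' b' c' d' : a * d - b * c = 1 -> a' * d' - b' * c' = 1 ->
  (a * a' + b * c') * (c * b' + d * d') - (a * b' + b * d') * (c * a' + d * c')
  = 1.
Proof. by move=> e e'; rewrite -[RHS](mulr1 1) -{1}e -e'; ring. Qed.

Lemma poincareJ a b c d a' b' c' d' g h :
  a * d - b * c = 1 -> a' * d' - b' * c' = 1 ->
  poincare_extension a b c d g -> poincare_extension a' b' c' d' h ->
  exists x y z w, [/\ x * w - y * z = 1, x + w = a + d &
     poincare_extension x y z w (g ^ h)%g].
Proof.
move=> det1 det1' Hg Hh; have det1V : d' * a' - - b' * - c' = 1.
  by rewrite mulrNN mulrC.
have := poincare_comp (det1M det1 det1') (poincareV det1' Hh)
          (poincare_comp det1' Hg Hh).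
set x := (X in poincare_extension X _ _ _ _).
set y := (X in poincare_extension _ X _ _ _).
set z := (X in poincare_extension _ _ X _ _).
set w := (X in poincare_extension _ _ _ X _).
move=> H; exists x, y, z, w; split => //; first exact: det1M (det1M _ _).
rewrite /x /w -[RHS]mulr1 -[in RHS]det1'; ring.
Qed.

(* For [p] moved to [j], [2 cosh d(p, g p) = |M|^2] and
   [2 cosh d(p, g (g p)) = |M^2|^2 = |tr M . M - 1|^2]; on a translated geodesic
   the two distances are [L] and [2 L]. *)
Lemma trace_bound a b c d g L : a * d - b * c = 1 ->
  poincare_extension a b c d g -> translates g L ->
  cosh2 L - 2 <= nsq (a + d).
Proof.
move=> det1 Hg [L0 [ga gga tr]].
have [al [de [be [P [p0 [det1' HP z0 t0 Po]]]]]] := conj_to_center (ga 0).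
have [h1 h2] := translates_hdist 0 L0 gga tr.
have S1 : 2 * (1 + cdist p0 ((g ^ P)%g p0)) = cosh2 L.
  by rewrite -cosh2_hdist -(isom_dist P) isomJE Po h1.
have S2 : 2 * (1 + cdist p0 ((g ^ P * g ^ P)%g p0)) = cosh2 L ^+ 2 - 2.
  by rewrite -cosh2_hdist -(isom_dist P) /= !isomJE Po h2 cosh2_double.
move: S1 S2.
have {}det1' : al * de - be * 0 = 1 by rewrite mulr0 subr0.
have [x [y [z [w [det <- Hh]]]]] := poincareJ det1 det1' Hg HP.
rewrite (cdist_center det Hh z0 t0).
rewrite (cdist_center (g := (g ^ P * g ^ P)%g) (det1M det det)
           (poincare_comp det Hh Hh) z0 t0).
set C := cosh2 L => S1 S2; pose T := nsq (x + w).
(* By Cayley-Hamilton [M^2 = t M - 1] with [t] the trace, so [|M^2|^2 = T C - 2 Re(t^2) + 2]; then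
   [Re(t^2) = 2 (Re t)^2 - T] leaves a real square. The left side also factors as
   [(T - (C - 2)) (C + 2)]. *)
have key : T * (C + 2) + 2 - (C ^+ 2 - 2) = (2 * complex.Re (x + w)) ^+ 2.
  rewrite -S2 -S1 /T; apply: complexI; rewrite [RHS]real_complexX.
  have -> : (2 * complex.Re (x + w))%:C = (x + w) + conjc (x + w).
    by rewrite addcJ real_complexM real_complex_nat.
  rewrite !(sqr_normcE, rcE) !cjE.
  have det1C : conjc x * conjc w - conjc y * conjc z = 1.
    by rewrite -!conjcM -conjcN -conjcD det conjc1.
  move: det det1C; move: (conjc x) (conjc y) (conjc z) (conjc w).
  move=> X Y Z W e E.
  have -> : x * x + y * z = (x + w) * x - 1 by rewrite -e; ring.
  have -> : z * y + w * w = (x + w) * w - 1 by rewrite -e; ring.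
  have -> : X * X + Y * Z = (X + W) * X - 1 by rewrite -E; ring.
  have -> : Z * Y + W * W = (X + W) * W - 1 by rewrite -E; ring.
  by ring.
have C2 : 0 < C + 2 by rewrite /C /cosh2 !addr_gt0 ?expR_gt0.
have : 0 <= T * (C + 2) + 2 - (C ^+ 2 - 2) by rewrite key sqr_ge0.
have -> : T * (C + 2) + 2 - (C ^+ 2 - 2) = (T - (C - 2)) * (C + 2) by ring.
by rewrite pmulr_lge0 // subr_ge0.
Qed.

End Loxodromic.

(** * Diagonal matrices, their axis and their roots *)

Section Axis.
Variable R : realType.
Implicit Types (a b c d z w mu : R[i]) (p q : H3 R) (g h : isom R) (L : R).

Lemma poincare_diagE mu g p : mu != 0 -> poincare_extension mu 0 0 mu^-1 g ->
  zcoord (g p) = mu ^+ 2 * zcoord p /\ height (g p) = nsq mu * height p.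
Proof.
move=> mu0 Hg; have det1 : mu * mu^-1 - 0 * 0 = 1 by rewrite mulr0 subr0 divff.
have cmu0 : conjc mu != 0 by rewrite conjc_eq0.
have [] := (poincareE _ _ _ _ g).1 Hg p; rewrite /denomC /=.
rewrite !(mulr0, mul0r, addr0, add0r, conjc0) conjc_inv => zg tg; split.
  by rewrite zg; field; rewrite mu0 cmu0.
by apply: complexI; rewrite tg real_complexM sqr_normcE; field; rewrite mu0 cmu0.
Qed.

Lemma nsq_pm1 z : nsq (z - 1) = nsq z + 1 - 2 * complex.Re z /\
                  nsq (z + 1) = nsq z + 1 + 2 * complex.Re z.
Proof. by case: z => x y; rewrite !nsqE /=; split; ring. Qed.

Lemma Re_le_nsq z (m : R) : 0 <= m -> nsq z = m ^+ 2 -> complex.Re z <= m.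
Proof. by case: z => x y m0; rewrite nsqE /= => e; nra. Qed.

(* [d(p, g (g p)) = 2 d(p, g p)] characterises the points of the axis of [g]. *)
Lemma diag_axis mu g p L : mu != 0 -> nsq mu != 1 ->
  poincare_extension mu 0 0 mu^-1 g ->
  hdist p (g p) = L -> hdist p (g (g p)) = L + L ->
  zcoord p = 0 /\ cosh2 L = nsq mu + (nsq mu)^-1.
Proof.
move=> mu0 m1 Hg h1 h2.
have [zg tg] := poincare_diagE p mu0 Hg.
have [zgg tgg] := poincare_diagE (g p) mu0 Hg.
have := cosh2_hdist p (g p); have := cosh2_hdist p (g (g p)).
rewrite h1 h2 cosh2_double /cdist zgg tgg zg tg.
rewrite (_ : zcoord p - mu ^+ 2 * zcoord p = - (zcoord p * (mu ^+ 2 - 1))); last by ring.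
rewrite (_ : zcoord p - mu ^+ 2 * (mu ^+ 2 * zcoord p) =
  - (zcoord p * (mu ^+ 2 - 1) * (mu ^+ 2 + 1))); last by ring.
rewrite !normcN !nsqM.
have [] := nsq_pm1 (mu ^+ 2); have := @Re_le_nsq (mu ^+ 2) (nsq mu) (sqr_ge0 _).
rewrite (nsqM mu mu : nsq (mu ^+ 2) = nsq mu ^+ 2) => /(_ erefl).
move: (complex.Re _) (nsq (_ - 1)) (nsq (_ + 1)) (cosh2 L) => w A B C.
have m0 : 0 < nsq mu by rewrite lt0r sqr_ge0 nsq_eq0 mu0.
have r0 : 0 <= nsq (zcoord p) by apply: sqr_ge0.
have t0 := height_gt0 p.
have z0 : (nsq (zcoord p) = 0) -> zcoord p = 0 by move/eqP; rewrite nsq_eq0 => /eqP.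
move: (nsq mu) m0 m1 (nsq (zcoord p)) r0 z0 (height p) t0.
move=> m m0 m1 r r0 z0 t t0 wm AE BE e2 e1.
have e1' : C * m * t ^+ 2 = A * r + (m ^+ 2 + 1) * t ^+ 2.
  by rewrite e1; field; rewrite !gt_eqF.
have e2' : (C ^+ 2 - 2) * m ^+ 2 * t ^+ 2 = A * B * r + (m ^+ 4 + 1) * t ^+ 2.
  by rewrite e2; field; rewrite !gt_eqF.
(* Eliminating [C] between [e1'] and [e2']. Here [A >= (m - 1)^2] and [B <= (m + 1)^2 < 2 m^2 + 2]
   because [m] is not 1, so the product vanishes only for [r = 0], on the axis. *)
have prod0 : A * r * (A * r + (2 * m ^+ 2 + 2 - B) * t ^+ 2) = 0.
  have -> : A * r * (A * r + (2 * m ^+ 2 + 2 - B) * t ^+ 2) =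
    (A * r + (m ^+ 2 + 1) * t ^+ 2) ^+ 2
    - (A * B * r + (m ^+ 4 + 1) * t ^+ 2 + 2 * m ^+ 2 * t ^+ 2) * t ^+ 2 by ring.
  by rewrite -e1' -e2'; ring.
have m1' : 0 < (m - 1) ^+ 2 by rewrite lt0r sqr_ge0 sqrf_eq0 subr_eq0 m1.
have A0 : 0 < A by nra.
have B0 : 0 < (2 * m ^+ 2 + 2 - B) * t ^+ 2.
  by rewrite mulr_gt0 ?exprn_gt0 //; nra.
have r00 : r = 0.
  move/eqP: prod0; rewrite !mulf_eq0 (gt_eqF A0) /= => /orP[/eqP//|].
  by rewrite gt_eqF // ltr_wpDl // mulr_ge0 // ltW.
split; first exact: z0.
move: e1'; rewrite r00 mulr0 add0r => /mulIf e.
have {}e : C * m = m ^+ 2 + 1 by apply: e; rewrite expf_neq0 // gt_eqF.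
by apply: (mulIf (lt0r_neq0 m0)); rewrite e mulrDl mulVf ?gt_eqF.
Qed.

Lemma hdist_axis p q : zcoord p = 0 -> zcoord q = 0 ->
  hdist p q = `|ln (height p) - ln (height q)|.
Proof.
move=> zp zq; apply: cosh2_inj; rewrite ?hdist_ge0 //.
have cosh2_norm (x : R) : cosh2 `|x| = cosh2 x.
  have [x0|x0] := leP 0 x; first by rewrite ger0_norm.
  by rewrite ltr0_norm // /cosh2 opprK addrC.
rewrite cosh2_norm cosh2_hdist /cosh2 /cdist zp zq subrr Normc.normc0 opprB !expRB.
have := height_gt0 p; have := height_gt0 q; move: (height p) (height q) => t s s0 t0.
by rewrite !lnK ?posrE //; field; rewrite !gt_eqF.
Qed.

Lemma axis_line : exists ga : R -> H3 R,
  geodesic_line ga /\ (forall u, zcoord (ga u) = 0 /\ ln (height (ga u)) = u).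
Proof.
have /choice[ga gaP] : forall u : R, exists p : H3 R,
    zcoord p = 0 /\ ln (height p) = u.
  move=> u; have [p zp tp] := H3_exists 0 (expR_gt0 u).
  by exists p; rewrite zp tp expRK.
exists ga; split=> // s t; have [zs ts] := gaP s; have [zt tt] := gaP t.
by rewrite hdist_axis // ts tt.
Qed.

Lemma axis_inj p q : zcoord p = 0 -> zcoord q = 0 ->
  ln (height p) = ln (height q) -> p = q.
Proof.
move=> zp zq e; apply: H3_eq; first by rewrite zp zq.
by apply: ln_inj; rewrite ?posrE ?height_gt0.
Qed.

Lemma diag_translates mu g : 1 < nsq mu -> poincare_extension mu 0 0 mu^-1 g ->
  translates g (ln (nsq mu)).
Proof.
move=> m1 Hg; split; first exact: ln_gt0.
have mu0 : mu != 0 by apply: contraTneq m1 => ->; rewrite Normc.normc0 expr0n ltr10.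
have [ga [gga gaP]] := axis_line; exists ga => // t.
have [z1 t1] := gaP t; have [z2 t2] := gaP (t + ln (nsq mu)).
have [zg tg] := poincare_diagE (ga t) mu0 Hg.
have lnE : ln (nsq mu * height (ga t)) = ln (nsq mu) + t.
  by rewrite (@lnM _ (nsq mu)) ?posrE ?height_gt0 ?t1 ?(lt_trans ltr01 m1).
by apply: axis_inj; rewrite ?zg ?z1 ?mulr0 // t2 tg lnE addrC.
Qed.

Lemma diag_translates_uniq mu g L : 1 < nsq mu ->
  poincare_extension mu 0 0 mu^-1 g -> translates g L -> L = ln (nsq mu).
Proof.
move=> m1 Hg [L0 [ga gga tr]].
have mu0 : mu != 0 by apply: contraTneq m1 => ->; rewrite Normc.normc0 expr0n ltr10.
have [h1 h2] := translates_hdist 0 L0 gga tr.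
have m0 : 0 < nsq mu by apply: lt_trans ltr01 m1.
have [_ e] := diag_axis mu0 (negbT (gt_eqF m1)) Hg h1 h2.
apply: cosh2_inj; rewrite ?ltW ?ln_gt0 // e /cosh2 expRN lnK //.
Qed.

(** A root [h] commutes with [g], hence preserves its axis and acts there as an isometry of the real
    line commuting with a translation, so as a translation itself. No matrix for [h] is assumed: it
    may be any isometry. *)
Lemma diag_root_translates mu g h s : 1 < nsq mu ->
  poincare_extension mu 0 0 mu^-1 g -> (0 < s)%N -> (h ^+ s)%g = g ->
  translates h (ln (nsq mu) / s%:R).
Proof.
move=> m1 Hg s0 hs.
have mu0 : mu != 0 by apply: contraTneq m1 => ->; rewrite Normc.normc0 expr0n ltr10.
set L := ln (nsq mu); have L0 : 0 < L by apply: ln_gt0.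
have [ga [gga gaP]] := axis_line.
have tr t : ga (t + L) = g (ga t).
  have [z1 t1] := gaP t; have [z2 t2] := gaP (t + L).
  have [zg tg] := poincare_diagE (ga t) mu0 Hg.
  have lnE : ln (nsq mu * height (ga t)) = ln (nsq mu) + t.
    by rewrite (@lnM _ (nsq mu)) ?posrE ?height_gt0 ?t1 ?(lt_trans ltr01 m1).
  by apply: axis_inj; rewrite ?zg ?z1 ?mulr0 // t2 tg lnE addrC.
have comm p : h (g p) = g (h p).
  rewrite -hs; have /(congr1 (fun f : isom R => f p)) := commuteX s (commute_refl h).
  by [].
(* By commutation [h (ga t)] satisfies the same two distance equations as [ga t], and [diag_axis]
   applies to it. *)
have ax t : zcoord (h (ga t)) = 0.
  have [h1 h2] := translates_hdist t L0 gga tr.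
  have [] // := @diag_axis mu g (h (ga t)) L mu0 (negbT (gt_eqF m1)) Hg.
    by rewrite -comm isom_dist.
  by rewrite -!comm isom_dist.
pose sg t := ln (height (h (ga t))).
have sgd t u : `|sg t - sg u| = `|t - u|.
  by rewrite -hdist_axis ?ax // isom_dist gga.
have hga t : h (ga t) = ga (sg t).
  by have [z1 t1] := gaP (sg t); apply: axis_inj; rewrite ?ax ?z1.
have sgL t : sg (t + L) = sg t + L.
  have : ga (sg (t + L)) = ga (sg t + L) by rewrite -hga tr comm hga tr.
  by move/(congr1 (fun p => ln (height p))); rewrite !(gaP _).2.
(* The reflection is excluded by subtracting [(sg t - sg 0)^2 = t^2] from the same equation at
   [t + L]. *)
have sgE t : sg t = t + sg 0.
  have := sgd t 0; have := sgd (t + L) 0; rewrite sgL !subr0 => e1 e2.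
  have sq (x y : R) : `|x| = `|y| -> x ^+ 2 = y ^+ 2.
    by move=> e; rewrite -(real_normK (num_real x)) e real_normK ?num_real.
  have {}e1 := sq _ _ e1; have {}e2 := sq _ _ e2.
  apply: (mulfI (lt0r_neq0 L0)); move: e1 e2; move: (sg t) (sg 0) => x y e1 e2.
  by nra.
have sgX n t : (h ^+ n)%g (ga t) = ga (t + n%:R * sg 0).
  elim: n t => [|n IH] t; first by rewrite mul0r addr0 expg0.
  by rewrite expgSr /= hga IH sgE -natr1; congr ga; ring.
have sL : s%:R * sg 0 = L.
  have : ga (0 + s%:R * sg 0) = ga (0 + L) by rewrite -sgX hs tr.
  by move/(congr1 (fun p => ln (height p))); rewrite !(gaP _).2 !add0r.
have -> : L / s%:R = sg 0 by rewrite -sL mulrC mulKf // pnatr_eq0 -lt0n.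
split; first by move: L0; rewrite -sL pmulr_rgt0 // ltr0n.
by exists ga => // t; rewrite hga (sgE t).
Qed.

End Axis.

(** * Diagonalization: the trace determines the translation length *)

Section Diagonalization.
Variable R : realType.
Implicit Types (a b c d z w mu tau : R[i]) (p q : H3 R) (g h : isom R) (L : R).

(** The roots of [X^2 - tau X + 1] have product 1, so one of them has modulus at least 1. *)
Lemma eigenvalue_exists tau : exists mu,
  [/\ mu != 0, 1 <= Normc.normc mu & mu + mu^-1 = tau].
Proof.
pose s := sqrtc (tau ^+ 2 - 4); have s2 : s ^+ 2 = tau ^+ 2 - 4 by rewrite sqr_sqrtc.
have prod1 : (tau + s) / 2 * ((tau - s) / 2) = 1.
  have -> : (tau + s) / 2 * ((tau - s) / 2) = (tau ^+ 2 - s ^+ 2) / 4 by field.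
  by rewrite s2; field.
have [x [y [xy1 xyt x1]]] : exists x y : R[i],
    [/\ x * y = 1, x + y = tau & 1 <= Normc.normc x].
  have n1 := congr1 (@Normc.normc R) prod1; rewrite Normc.normcM Normc.normc1 in n1.
  have n0 := normc_ge0 ((tau + s) / 2); have n0' := normc_ge0 ((tau - s) / 2).
  have [le1|lt1] := leP 1 (Normc.normc ((tau + s) / 2)).
    by exists ((tau + s) / 2), ((tau - s) / 2); split=> //; field.
  exists ((tau - s) / 2), ((tau + s) / 2); split; [by rewrite mulrC | by field |].
  by nra.
have x0 : x != 0 by apply: contra_eq_neq xy1 => ->; rewrite mul0r eq_sym oner_eq0.
exists x; split=> //; rewrite -xyt; congr (_ + _).
by apply: (mulfI x0); rewrite divff.
Qed.

Lemma normcV_le1 mu : 1 <= Normc.normc mu -> Normc.normc mu^-1 <= 1.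
Proof. by move=> m1; rewrite Normc.normcV invf_le1 // (lt_le_trans ltr01). Qed.

(** An eigenvalue of modulus 1 would give [|mu + mu^-1| <= 2]. *)
Lemma eigenvalue_gt1 tau : 4 < nsq tau -> exists mu,
  [/\ mu != 0, 1 < nsq mu & mu + mu^-1 = tau].
Proof.
move=> t4; have [mu [mu0 mu1 e]] := eigenvalue_exists tau.
exists mu; split => //; suff: 1 < Normc.normc mu by move=> ?; nra.
rewrite lt_neqAle mu1 andbT.
apply: contraTneq t4 => /esym m1; rewrite -leNgt -e.
have := le_normcD mu mu^-1; have := normcV_le1 mu1.
have := normc_ge0 (mu + mu^-1); rewrite m1.
by move: (Normc.normc _) (Normc.normc _) => x y; nra.
Qed.

Lemma diagonalize a b c d mu g : a * d - b * c = 1 -> c != 0 -> mu != 0 ->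
  1 < nsq mu -> mu + mu^-1 = a + d -> poincare_extension a b c d g ->
  exists P : isom R, poincare_extension mu 0 0 mu^-1 (g ^ P)%g.
Proof.
move=> det1 c0 mu0 mu1 tr Hg.
have dmu : mu - mu^-1 != 0.
  rewrite subr_eq0; apply: contraTneq mu1 => e.
  have : nsq mu * nsq mu = 1 by rewrite {1}e nsqV mulVf // nsq_eq0.
  by rewrite -leNgt; have := sqr_ge0 (Normc.normc mu); move: (nsq mu) => x; nra.
have det_diag : mu * mu^-1 - 0 * 0 = 1 by rewrite mulfV // mul0r subr0.
have [D HD] := poincare_exists det_diag.
move: tr dmu det_diag HD; have : mu * mu^-1 = 1 by rewrite mulfV.
move: mu^-1 => nu munu tr dmu det_diag HD.
(* The columns of [P] are the eigenvectors [(mu - d, c)] and [(nu - d, c)]; dividing the second by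
   [e] makes the determinant 1. *)
set e := c * (mu - nu); have e0 : e != 0 by rewrite mulf_neq0.
have detP : (mu - d) * (c / e) - (nu - d) / e * c = 1.
  by rewrite /e; field; rewrite c0 dmu.
have [P HP] := poincare_exists detP; exists P; suff -> : (g ^ P)%g = D by [].
rewrite conjgE; suff -> : (g * P = P * D)%g by rewrite mulKg.
apply: poincare_uniq; first exact: poincare_comp Hg HP.
have := poincare_comp det_diag HP HD.
have bcE : b * c = a * d - 1 by rewrite -det1; ring.
have mu2 : mu ^+ 2 = (a + d) * mu - 1 by rewrite -tr -munu; ring.
have nu2 : nu ^+ 2 = (a + d) * nu - 1 by rewrite -tr -munu; ring.
have -> : (mu - d) * mu + (nu - d) / e * 0 = a * (mu - d) + b * c.
  by rewrite bcE mulr0 addr0 mulrBl -expr2 mu2; ring.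
have -> : (mu - d) * 0 + (nu - d) / e * nu = a * ((nu - d) / e) + b * (c / e).
  have -> : a * ((nu - d) / e) + b * (c / e) = (a * (nu - d) + b * c) / e by ring.
  rewrite bcE mulr0 add0r; have -> : (nu - d) / e * nu = (nu ^+ 2 - d * nu) / e by ring.
  by rewrite nu2; congr (_ / _); ring.
have -> : c * mu + c / e * 0 = c * (mu - d) + d * c by ring.
by have -> : c * 0 + c / e * nu = c * ((nu - d) / e) + d * (c / e) by ring.
Qed.

(** Both isometries are conjugate to the same diagonal one, whose translation length is unique. *)
Lemma translates_same_trace a b c d a' b' c' d' g h L :
  a * d - b * c = 1 -> a' * d' - b' * c' = 1 -> c != 0 -> c' != 0 ->
  a + d = a' + d' -> 4 < nsq (a + d) ->
  poincare_extension a b c d g -> poincare_extension a' b' c' d' h ->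
  translates g L -> translates h L.
Proof.
move=> det1 det1' c0 c0' tr tr4 Hg Hh gL.
have [mu [mu0 mu1 muE]] := eigenvalue_gt1 tr4.
have [P HP] := diagonalize det1 c0 mu0 mu1 muE Hg.
rewrite tr in muE; have [Q HQ] := diagonalize det1' c0' mu0 mu1 muE Hh.
have -> := diag_translates_uniq mu1 HP (translatesJ P gL).
by rewrite -(conjgK Q h); exact/translatesJ/diag_translates.
Qed.

Lemma root_translates a b c d g h s L :
  a * d - b * c = 1 -> c != 0 -> 4 < nsq (a + d) ->
  poincare_extension a b c d g -> translates g L ->
  (0 < s)%N -> (h ^+ s)%g = g -> translates h (L / s%:R).
Proof.
move=> det1 c0 tr4 Hg gL s0 hs.
have [mu [mu0 mu1 muE]] := eigenvalue_gt1 tr4.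
have [P HP] := diagonalize det1 c0 mu0 mu1 muE Hg.
have -> := diag_translates_uniq mu1 HP (translatesJ P gL).
rewrite -(conjgK P h); apply: translatesJ.
by apply: (diag_root_translates mu1 HP s0); rewrite -conjXg hs.
Qed.

End Diagonalization.

(** * Powers of a matrix of determinant 1 *)

Section Chebyshev.

(* Indexed so that [M ^ n = cheb (tr M) n.+1 *: M - cheb (tr M) n] for every [n]
   when [\det M = 1]. *)
Fixpoint cheb (A : pzRingType) (t : A) (n : nat) : A :=
  if n is n1.+1 then if n1 is n2.+1 then t * cheb t n1 - cheb t n2 else 0
  else -1.

Lemma chebSS (A : pzRingType) (t : A) n :
  cheb t n.+2 = t * cheb t n.+1 - cheb t n.
Proof. by []. Qed.

(** The form [x^2 - t x y + y^2] is invariant under the recurrence; it is the determinant of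
    [x M - y] when [M] has trace [t] and determinant 1. *)
Lemma cheb_det (A : comPzRingType) (t : A) n :
  cheb t n.+1 ^+ 2 - t * cheb t n.+1 * cheb t n + cheb t n ^+ 2 = 1.
Proof.
elim: n => [|n IH]; first by rewrite /=; ring.
by rewrite -[RHS]IH chebSS; ring.
Qed.

Variable R : realType.
Implicit Types (a b c d mu tau : R[i]) (g h : isom R).

Lemma poincareX a b c d g n : a * d - b * c = 1 ->
  poincare_extension a b c d g ->
  let W := cheb (a + d) in
  (W n.+1 * a - W n) * (W n.+1 * d - W n) - (W n.+1 * b) * (W n.+1 * c) = 1 /\
  poincare_extension (W n.+1 * a - W n) (W n.+1 * b)
                     (W n.+1 * c) (W n.+1 * d - W n) (g ^+ n)%g.
Proof.
move=> det1 Hg W.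
have det n' : (W n'.+1 * a - W n') * (W n'.+1 * d - W n') -
             (W n'.+1 * b) * (W n'.+1 * c) = 1.
  transitivity (W n'.+1 ^+ 2 * (a * d - b * c)
                - (a + d) * W n'.+1 * W n' + W n' ^+ 2); first by ring.
  by rewrite det1 mulr1 cheb_det.
split; first exact: det.
elim: n => [|n IH].
  rewrite expg0 [W 1%N]/= [W 0%N]/= !mul0r !sub0r !opprK.
  exact: poincare_id.
have := poincare_comp (det n) Hg IH; rewrite -expgS.
have bcE : b * c = a * d - 1 by rewrite -det1; ring.
have WE : W n.+2 = (a + d) * W n.+1 - W n by [].
have -> : a * (W n.+1 * a - W n) + b * (W n.+1 * c) = W n.+2 * a - W n.+1.
  transitivity (W n.+1 * (a * a + b * c) - W n * a); first by ring.
  by rewrite bcE WE; ring.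
have -> : a * (W n.+1 * b) + b * (W n.+1 * d - W n) = W n.+2 * b.
  by rewrite WE; ring.
have -> : c * (W n.+1 * a - W n) + d * (W n.+1 * c) = W n.+2 * c.
  by rewrite WE; ring.
have -> // : c * (W n.+1 * b) + d * (W n.+1 * d - W n) = W n.+2 * d - W n.+1.
transitivity (W n.+1 * (d * d + b * c) - W n * d); first by ring.
by rewrite bcE WE; ring.
Qed.

Lemma cheb_trace a d n : let W := cheb (a + d) in
  (W n.+1 * a - W n) + (W n.+1 * d - W n) = W n.+2 - W n.
Proof. by rewrite /= ; ring. Qed.

(** Binet's formulas. The first is not divided by [mu - mu^-1], so that [mu = 1] and [mu = -1] are
    covered; the second gives the trace of the [n]-th power. *)
Lemma cheb_eigen mu n : mu != 0 -> let W := cheb (mu + mu^-1) in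
  W n.+1 * (mu - mu^-1) = mu ^+ n - mu^-1 ^+ n /\
  W n.+2 - W n = mu ^+ n + mu^-1 ^+ n.
Proof.
move=> mu0 W; have munu : mu * mu^-1 = 1 by rewrite mulfV.
rewrite /W {W}; move: mu^-1 munu => nu munu.
have E m : cheb (mu + nu) m.+1 * (mu - nu) = mu ^+ m - nu ^+ m /\
           cheb (mu + nu) m.+2 * (mu - nu) = mu ^+ m.+1 - nu ^+ m.+1.
  elim: m => [|m [IH1 IH2]]; first by rewrite /=; split; ring.
  split=> //; rewrite chebSS mulrBl -mulrA IH2 IH1 !exprS.
  transitivity (mu * (mu * mu ^+ m) - nu * (nu * nu ^+ m)
                + (mu * nu - 1) * (mu ^+ m - nu ^+ m)); first by ring.
  by rewrite munu subrr mul0r addr0.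
split; first by case: (E n).
have T m : cheb (mu + nu) m.+2 - cheb (mu + nu) m = mu ^+ m + nu ^+ m /\
    cheb (mu + nu) m.+3 - cheb (mu + nu) m.+1 = mu ^+ m.+1 + nu ^+ m.+1.
  elim: m => [|m [IH1 IH2]]; first by rewrite /=; split; ring.
  split=> //; transitivity ((mu + nu) * (cheb (mu + nu) m.+3 - cheb (mu + nu) m.+1)
     - (cheb (mu + nu) m.+2 - cheb (mu + nu) m)).
    by rewrite (chebSS _ m.+2) (chebSS _ m); ring.
  rewrite IH2 IH1 !exprS.
  transitivity (mu * (mu * mu ^+ m) + nu * (nu * nu ^+ m)
                + (mu * nu - 1) * (mu ^+ m + nu ^+ m)); first by ring.
  by rewrite munu subrr mul0r addr0.
by case: (T n).
Qed.

Lemma normcX (z : R[i]) n : Normc.normc (z ^+ n) = Normc.normc z ^+ n.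
Proof.
elim: n => [|n IH]; first by rewrite !expr0 Normc.normc1.
by rewrite !exprS Normc.normcM IH.
Qed.

Lemma normc_ltB (z w : R[i]) : Normc.normc z - Normc.normc w <= Normc.normc (z - w).
Proof. by rewrite lerBlDr -{1}(subrK w z) le_normcD. Qed.

(* With [mu] the larger eigenvalue and [s >= 2],
   [|mu|^s - 1 <= N (|mu| + 1) <= N (|mu|^(s/2) + 1)], so [|mu|^(s/2) <= N + 1]. *)
Lemma cheb_root_bound tau s (N : R) : (1 < s)%N -> 0 <= N ->
  Normc.normc (cheb tau s.+1) <= N ->
  Normc.normc (cheb tau s.+2 - cheb tau s) <= (N + 1) ^+ 2 + 1.
Proof.
move=> s1 N0; have [mu [mu0 mu1 <-]] := eigenvalue_exists tau.
have [e1 ->] := cheb_eigen s mu0; have nu1 := normcV_le1 mu1.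
have n0 := normc_ge0 mu^-1 => WN.
have nus : Normc.normc (mu^-1 ^+ s) <= 1 by rewrite normcX exprn_ile1.
apply: le_trans (le_normcD _ _) (lerD _ nus).
have h1 : Normc.normc (mu ^+ s) - 1 <= N * (Normc.normc mu + 1).
  apply: (@le_trans _ _ (Normc.normc (mu ^+ s - mu^-1 ^+ s))).
    by apply: le_trans (normc_ltB _ _); rewrite lerB.
  rewrite -e1 Normc.normcM ler_pM ?normc_ge0 //.
  by apply: le_trans (le_normcD _ _) _; rewrite normcN lerD.
rewrite normcX in h1 *; move: (Normc.normc mu) mu1 h1 => x x1 h1.
have xs : x ^+ 2 <= x ^+ s by rewrite ler_weXn2l.
have xs0 : 0 <= x ^+ s by apply: le_trans xs; apply: sqr_ge0.
have s2 := sqr_sqrtr xs0; have r0 := sqrtr_ge0 (x ^+ s).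
move: (Num.sqrt _) r0 s2 => r r0 s2; rewrite -s2 in h1 xs *.
have xr : x <= r by rewrite -(ler_pXn2r (n := 2)) ?nnegrE //; lra.
rewrite ler_pXn2r ?nnegrE //; last lra.
have [//|lt] := leP r (N + 1); nra.
Qed.

End Chebyshev.

(** * Arithmetic of the ring of integers *)

(** Transported along [ratr] from the corresponding fact about algebraic integers in [algC]. *)
Lemma rat_integral (q : rat) : integralOver (intr : int -> rat) q ->
  exists n : int, q = n%:~R.
Proof.
move=> [P monP rootP].
have /intrP[n e] : (ratr q : algC) \is a Num.int.
  apply: Cint_rat_Aint; first exact: Crat_rat.
  apply: (@root_monic_Aint (map_poly ratr (map_poly intr P))).
  - by rewrite fmorph_root.
  - by do 2!apply: monic_map.
  - rewrite -map_poly_comp; apply/polyOverP => i; rewrite coef_map /= ratr_int.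
    exact: intr_int.
by exists n; apply: (fmorph_inj (@ratr algC)); rewrite /= ratr_int.
Qed.

Section RingOfIntegers.
Variables (R : realType) (d : nat).
Implicit Types x y : R[i].

Local Notation O := (ring_of_integers (imag_quadratic_field (R := R) d)).
Local Notation sq := (0 +i* Num.sqrt (d%:R : R)).

Lemma integral_intr_rat (q : rat) :
  integralOver (intr : int -> R[i]) (ratr q) -> exists n : int, q = n%:~R.
Proof.
move=> [P monP rootP]; apply: rat_integral; exists P => //.
rewrite -(fmorph_root (@ratr R[i])) -map_poly_comp.
by rewrite (eq_map_poly (g := intr)) // => z /=; rewrite ratr_int.
Qed.

Lemma sq_sqr : sq ^+ 2 = - ratr d%:R.
Proof.
have -> : sq = 'i%C * (Num.sqrt (d%:R : R))%:C.
  by simpc.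
by rewrite exprMn sqr_i -real_complexX sqr_sqrtr ?ler0n // real_complex_nat mulN1r ratr_nat.
Qed.

Lemma conjc_sq : conjc sq = - sq.
Proof. by apply/eqP; rewrite eq_complex /= oppr0 !eqxx. Qed.

Lemma conjc_ratr (q : rat) : conjc (ratr q : R[i]) = ratr q.
Proof. exact: fmorph_rat. Qed.

Lemma ringint_int (n : int) : O n%:~R.
Proof.
split; last exact: integral_id.
by exists n%:~R, 0; rewrite ratr_int rmorph0 mul0r addr0.
Qed.

Lemma ringint_nat (n : nat) : O n%:R.
Proof. exact: (ringint_int n). Qed.

Lemma ringintB x y : O x -> O y -> O (x - y).
Proof.
move=> [[a [b ->]] ix] [[a' [b' ->]] iy]; split; last exact: integral_sub.
by exists (a - a'), (b - b'); rewrite !rmorphB /=; ring.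
Qed.

Lemma ringintD x y : O x -> O y -> O (x + y).
Proof.
move=> [[a [b ->]] ix] [[a' [b' ->]] iy]; split; last exact: integral_add.
by exists (a + a'), (b + b'); rewrite !rmorphD /=; ring.
Qed.

Lemma ringintM x y : O x -> O y -> O (x * y).
Proof.
move=> [[a [b ->]] ix] [[a' [b' ->]] iy]; split; last exact: integral_mul.
exists (a * a' - d%:R * (b * b')), (a * b' + b * a').
rewrite !(rmorphB, rmorphD, rmorphM) /=.
transitivity (ratr a * ratr a' + ratr b * ratr b' * sq ^+ 2 +
              (ratr a * ratr b' + ratr b * ratr a') * sq); first by ring.
by rewrite sq_sqr; ring.
Qed.

(** Trace and norm are rational by the shape [a + b sq] and integral as a sum and a product of
    integral elements. *)
Lemma ringint_conj x : O x -> exists u v : int,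
  x + conjc x = u%:~R /\ x * conjc x = v%:~R.
Proof.
move=> [[a [b xE]] ix].
have icx : integralOver (intr : int -> R[i]) (conjc x).
  have := integral_rmorph (conjc : {rmorphism R[i] -> R[i]}) ix.
  move=> [P monP rootP]; exists P => //; move: rootP.
  by rewrite (eq_map_poly (g := intr)) // => z /=; exact: rmorph_int.
have cxE : conjc x = ratr a - ratr b * sq.
  by rewrite xE conjcD (conjcM (ratr b)) !conjc_ratr conjc_sq mulrN.
have tE : x + conjc x = ratr (a + a) by rewrite cxE xE rmorphD /=; ring.
have nE : x * conjc x = ratr (a * a + d%:R * (b * b)).
  rewrite cxE xE rmorphD !rmorphM /=.
  transitivity (ratr a * ratr a - ratr b * ratr b * sq ^+ 2); first by ring.
  by rewrite sq_sqr; ring.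
have [u uE] : exists u : int, a + a = u%:~R.
  by apply: integral_intr_rat; rewrite -tE; exact: integral_add.
have [v vE] : exists v : int, a * a + d%:R * (b * b) = v%:~R.
  by apply: integral_intr_rat; rewrite -nE; exact: integral_mul.
by exists u, v; rewrite tE nE uE vE !ratr_int.
Qed.

Lemma ringint_quadratic x : O x -> exists u v : int, x ^+ 2 = u%:~R * x - v%:~R.
Proof.
by move=> /ringint_conj[u [v [e1 e2]]]; exists u, v; rewrite -e1 -e2; ring.
Qed.

(** The squared modulus is the norm, a positive integer. *)
Lemma ringint_normc_ge1 x : O x -> x != 0 -> 1 <= Normc.normc x.
Proof.
move=> /ringint_conj[u [v [_ vE]]] x0.
have vR : Normc.normc x ^+ 2 = v%:~R.
  by apply: complexI; rewrite sqr_normcE vE; exact/esym/(rmorph_int (real_complex R)).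
have n0 := normc_ge0 x; suff : 1 <= Normc.normc x ^+ 2 by move=> ?; nra.
rewrite vR ler1z -gtz0_ge1  -(ltr0z R) -vR exprn_gt0 // lt0r n0 andbT.
by apply: contra_neq x0 => /Normc.eq0_normc.
Qed.

End RingOfIntegers.

(** * Periodicity of the traces of powers modulo an integer *)

Section Periodicity.

Lemma intr_Zp_eq0 (m : nat) (z : int) : (1 < m)%N ->
  z%:~R = 0 :> 'Z_m -> exists k : int, z = m%:Z * k.
Proof.
move=> m1; suff nat_case (n : nat) : n%:R = 0 :> 'Z_m -> exists k : int, n%:Z = m%:Z * k.
  case: z => n; first exact: nat_case.
  rewrite NegzE mulrNz => /eqP; rewrite oppr_eq0 => /eqP/nat_case[k kE].
  by exists (- k); rewrite mulrN -kE.
move/(congr1 val); rewrite /= val_Zp_nat // => /eqP/dvdnP[k ->].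
by exists k%:Z; rewrite mulrC PoszM.
Qed.

(* [((p, q), (p', q'))] stands for two consecutive terms [p + q t] and [p' + q' t]
   of the sequence [cheb t], where [t ^+ 2 = u t - v]. *)
Definition cheb_step (A : pzRingType) (u v : A) (s : (A * A) * (A * A)) :=
  (s.2, (- (v * s.2.2) - s.1.1, s.2.1 + u * s.2.2 - s.1.2)).

Definition cheb_state (A : pzRingType) (u v : A) (n : nat) :=
  iter n (cheb_step u v) ((- 1, 0), (0, 0)).

Lemma cheb_step_inj (A : pzRingType) (u v : A) : injective (cheb_step u v).
Proof.
move=> [[p q] [p' q']] [[r s] [r' s']] [/= -> ->] => /addrI/oppr_inj ->.
by move=> /addrI/oppr_inj ->.
Qed.

Lemma cheb_stateE (A : comPzRingType) (t : A) (u v : int) n :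
  t ^+ 2 = u%:~R * t - v%:~R ->
  let s := cheb_state u v n in
  cheb t n = s.1.1%:~R + s.1.2%:~R * t /\
  cheb t n.+1 = s.2.1%:~R + s.2.2%:~R * t.
Proof.
move=> tE; elim: n => [|n]; first by rewrite /= mul0r !addr0.
rewrite /cheb_state iterS; move: (iter n _ _) => [[p q] [p' q']] [e1 e2].
split; first exact: e2.
rewrite chebSS e1 e2 /= !(rmorphB, rmorphN, rmorphM, rmorphD) /=.
transitivity (p'%:~R * t + q'%:~R * t ^+ 2 - (p%:~R + q%:~R * t)); first by ring.
by rewrite tE; ring.
Qed.

Lemma cheb_state_intr (A : pzRingType) (u v : int) n :
  let s := cheb_state u v n in
  cheb_state (u%:~R : A) v%:~R n =
  ((s.1.1%:~R, s.1.2%:~R), (s.2.1%:~R, s.2.2%:~R)).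
Proof.
elim: n => [|n]; first by rewrite /= rmorphN rmorph1.
rewrite /cheb_state !iterS => ->; move: (iter n _ _) => [[p q] [p' q']] /=.
by rewrite /cheb_step /= !(rmorphB, rmorphN, rmorphM, rmorphD).
Qed.

(** An injective map of the finite set of states is a permutation, so the orbit returns to the
    initial state itself and not merely to some cycle. *)
Lemma cheb_state_period (m : nat) (u v : int) : (1 < m)%N ->
  exists2 n0, (0 < n0)%N & forall q,
    cheb_state (u%:~R : 'Z_m) v%:~R (n0 * q) = ((- 1, 0), (0, 0)).
Proof.
move=> m1; set F := cheb_step (u%:~R : 'Z_m) v%:~R.
have Finj : injective F by exact: cheb_step_inj.
exists (fingraph.order F ((- 1, 0), (0, 0))); first exact: order_gt0.
elim=> [|q IH]; first by rewrite muln0.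
by rewrite mulnS /cheb_state iterD [X in iter _ _ X]IH iter_order.
Qed.

Lemma cheb_trace_period (R : realType) (d m : nat) (t : R[i]) : (1 < m)%N ->
  ring_of_integers (imag_quadratic_field d) t ->
  exists2 n0, (0 < n0)%N & forall q, exists2 y,
    ring_of_integers (imag_quadratic_field d) y &
    cheb t (n0 * q).+2 - cheb t (n0 * q) = 2 + m%:R * y.
Proof.
move=> m1 Ot; have [u [v tE]] := ringint_quadratic Ot.
have [n0 n00 per] := cheb_state_period u v m1; exists n0 => // q.
have := per q; rewrite cheb_state_intr.
have [] := cheb_stateE (n0 * q) tE; rewrite chebSS => -> ->.
move: (cheb_state u v _) => [[p r] [p' r']] /= [].
move=> pE /(intr_Zp_eq0 m1)[j ->] /(intr_Zp_eq0 m1)[k ->] /(intr_Zp_eq0 m1)[l ->].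
have [i iE] : exists i : int, p + 1 = m%:Z * i.
  by apply: intr_Zp_eq0 => //; rewrite rmorphD /= pE addNr.
have {iE pE} -> : p = m%:Z * i - 1 by rewrite -iE addrK.
(* The trace is [t W' - 2 W], where [W' = m (k + l t)] and [W = m (i + j t) - 1] are the two
   consecutive terms. *)
exists (t * (k%:~R + l%:~R * t) - 2%:R * (i%:~R + j%:~R * t)).
  have Oi := ringint_int R d; have On := ringint_nat R d.
  by apply: ringintB; apply: ringintM => //; apply: ringintD => //; apply: ringintM.
by rewrite !(rmorphB, rmorphM) /=; ring.
Qed.

End Periodicity.

(** * Subgroups of finite index and primitive elements *)

Section Groups.
Variable R : realType.
Implicit Types (a b c d z w : R[i]) (g h : isom R) (L : R).

(** Pigeonhole on the cosets of the powers of [g]; the bound is the number of cosets, uniform in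
    [g]. As [G] is a mere predicate, the powers are assumed to lie in it. *)
Lemma finite_index_power (D G : {pred isom R}) : finite_index D G -> 1%g \in D ->
  exists I : nat, forall g, (forall n, (g ^+ n)%g \in G) ->
  exists j, [/\ (0 < j)%N, (j <= I)%N & (g ^+ j)%g \in D].
Proof.
move=> [_ /finite_seqP[s sE]] D1; exists (size s) => g gG.
pose coset n := [set (g ^+ n * h)%g | h in [set` D]]%classic.
have cs n : coset n \in s.
  have : [set` s]%classic (coset n) by rewrite -sE; exists (g ^+ n)%g => //; exact: gG.
  by [].
have /(uniqPn set0)[i [j [ij]]] : ~~ uniq [seq coset n | n <- iota 0 (size s).+1].
  apply/negP => cuniq.
  suff /(uniq_leq_size cuniq) : {subset [seq coset n | n <- iota 0 (size s).+1] <= s}.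
    by rewrite size_map size_iota ltnn.
  by move=> _ /mapP[n _ ->].
rewrite size_map size_iota => js.
rewrite !(nth_map 0%N) ?size_iota ?(ltn_trans ij) // !nth_iota ?(ltn_trans ij) //.
rewrite !add0n => cij; exists (j - i)%N; split; first by rewrite subn_gt0.
  by rewrite (leq_trans (leq_subr _ _)).
have : coset j (g ^+ j)%g by exists 1%g; rewrite ?mulg1.
rewrite -cij => -[h hD /esym ghj].
suff -> : (g ^+ (j - i))%g = h by [].
by apply: (mulgI (g ^+ i)%g); rewrite -expgnDr subnKC ?(ltnW ij).
Qed.

Lemma power_order_dvd (D : groupClosed (isom R)) g j s : (0 < j)%N ->
  (g ^+ j)%g \in D -> (forall i, (0 < i)%N -> (g ^+ i)%g \in D -> (j <= i)%N) ->
  (g ^+ s)%g \in D -> (j %| s)%N.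
Proof.
move=> j0 gj jmin gs; rewrite /dvdn eqn0Ngt; apply/negP => r0.
have := jmin _ r0; rewrite leqNgt ltn_mod j0 => /(_ _)/negP; apply => //.
move: gs; rewrite {1}(divn_eq s j) mulnC expgnDr expgnA gpredMl //.
exact: gpredXn.
Qed.

(** The point [(0, t)] goes to height [t / (|d|^2 + |c|^2 t^2)]; the values at [t = 1] and [t = 2]
    determine [|c|]. *)
Lemma poincare_lower_left a b c d a' b' c' d' g :
  poincare_extension a b c d g -> poincare_extension a' b' c' d' g ->
  Normc.normc c = Normc.normc c'.
Proof.
move=> Hg Hg'.
have E (t : R) : 0 < t -> nsq d + nsq c * t ^+ 2 = nsq d' + nsq c' * t ^+ 2.
  move=> t0; have [p zp tp] := H3_exists 0 t0.
  have [_ e] := Hg p; have [_] := Hg' p; rewrite e.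
  rewrite zp tp !mulr0 !add0r => /(mulfI (lt0r_neq0 t0))/invr_inj.
  by [].
have e1 := E 1 ltr01; have e2 := E 2 (ltr0Sn _ _).
have n0 := normc_ge0 c; have n0' := normc_ge0 c'.
have /eqP : nsq c = nsq c' by lra.
by rewrite eqrXn2 // => /eqP.
Qed.

Lemma poincare_unipotentX z g n : poincare_extension 1 z 0 1 g ->
  poincare_extension 1 (n%:R * z) 0 1 (g ^+ n)%g.
Proof.
move=> Hg; elim: n => [|n IH]; first by rewrite mul0r expg0; exact: poincare_id.
have det w : 1 * 1 - w * 0 = 1 :> R[i] by rewrite mulr0 subr0 mulr1.
have := poincare_comp (det _) Hg IH; rewrite -expgS.
rewrite !(mul1r, mulr0, mul0r, addr0, add0r, mulr1).
by have -> : n%:R * z + z = n.+1%:R * z by rewrite -natr1; ring.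
Qed.

Lemma poincare_unipotent_transposeX z g n : poincare_extension 1 0 z 1 g ->
  poincare_extension 1 0 (n%:R * z) 1 (g ^+ n)%g.
Proof.
move=> Hg; elim: n => [|n IH]; first by rewrite mul0r expg0; exact: poincare_id.
have det w : 1 * 1 - 0 * w = 1 :> R[i] by rewrite mul0r subr0 mulr1.
have := poincare_comp (det _) Hg IH; rewrite -expgS.
rewrite !(mul1r, mulr0, mul0r, addr0, add0r, mulr1).
by have -> : z + n%:R * z = n.+1%:R * z by rewrite -natr1; ring.
Qed.

Variable Gam : groupClosed (isom R).

Lemma spectrum_translates L : in_multiset (primitive_length_spectrum Gam) L ->
  exists2 g, g \in Gam & translates g L.
Proof.
move=> [C [/= [g0 [g0G _] ->] [ga [L0 _ _]]]].
move=> [ga' [gga' _] [_ [h hG <-] tr]].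
by exists (g0 ^ h)%g; [exact: gpredJ | split => //; exists ga'].
Qed.

Lemma translates_spectrum g L : primitive_elt Gam g -> translates g L ->
  in_multiset (primitive_length_spectrum Gam) L.
Proof.
move=> prim [L0 [ga gga tr]]; have [gG _] := prim.
exists (conj_class Gam g); split; first by exists g.
have lift : geodesic_lift (fun t => hproj Gam (ga t)) ga by split.
exists (fun t => hproj Gam (ga t)).
  split=> //; first by exists ga.
  move=> t; rewrite tr; apply/esym/eqmodP/asboolP; by exists g.
exists ga => //; exists g => //; exists 1%g; first exact: gpred1.
exact: conjg1.
Qed.

(** Take the largest exponent: a proper root of [h] would be a root of [g] with a larger one. *)
Lemma maximal_root g (I : nat) : g \in Gam ->
  (forall h s, h \in Gam -> (0 < s)%N -> (h ^+ s)%g = g -> (s <= I)%N) ->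
  exists h s, [/\ primitive_elt Gam h, (0 < s)%N, (s <= I)%N & (h ^+ s)%g = g].
Proof.
move=> gG bnd.
pose Q s := `[< exists h, [/\ h \in Gam, (0 < s)%N & (h ^+ s)%g = g] >].
have exQ : exists s, Q s by exists 1%N; apply/asboolP; exists g; rewrite expg1.
have bndQ s : Q s -> (s <= I)%N by move=> /asboolP[h [hG s0 hs]]; exact: bnd hs.
case: (ex_maxnP exQ bndQ) => s /asboolP[h [hG s0 hs]] smax.
exists h, s; split => //; last exact: bnd hs.
split=> // -[h' [n [hG' _ n1 hh']]].
have /smax : Q (n * s)%N.
  apply/asboolP; exists h'; rewrite expgnA -hh' muln_gt0 s0 (ltn_trans _ n1) //.
by rewrite leqNgt ltn_Pmull.
Qed.

End Groups.

(** * Elements of [PSL2 O] with prescribed trace, and their roots *)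

Section Arithmetic.
Variables (R : realType) (d : nat).
Implicit Types (a b c e z w y : R[i]) (g h f : isom R) (L : R).

Local Notation O := (ring_of_integers (imag_quadratic_field (R := R) d)).

Lemma ringint_cheb t n : O t -> O (cheb t n).
Proof.
move=> Ot; have Oi := ringint_int R d.
suff [] : O (cheb t n) /\ O (cheb t n.+1) by [].
elim: n => [|n [IH1 IH2]]; first by split; [exact: (Oi (-1)) | exact: (Oi 0)].
by split=> //; apply: ringintB => //; exact: ringintM.
Qed.

Lemma PSL2P g : g \in PSL2 O -> exists a b c e,
  [/\ O a, O b, O c & O e] /\ a * e - b * c = 1 /\ poincare_extension a b c e g.
Proof. by move/asboolP. Qed.

(** The factorial is a multiple of every possible [j], so a single exponent serves all elements. *)
Lemma fact_power_in_finite_index (D : groupClosed (isom R)) f (I : nat) g :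
  (forall g, (forall n, (g ^+ n)%g \in PSL2 O) ->
     exists j, [/\ (0 < j)%N, (j <= I)%N & (g ^+ j ^ f)%g \in D]) ->
  (forall n, (g ^+ n)%g \in PSL2 O) -> (g ^+ I`! ^ f)%g \in D.
Proof.
move=> HI /HI[j [j0 jI gj]]; have /dvdnP[k ->] : (j %| I`!)%N by rewrite dvdn_fact ?j0.
by rewrite mulnC expgnA conjXg; exact: gpredXn.
Qed.

Lemma unipotent_products (D : groupClosed (isom R)) f :
  finite_index [pred g | (g ^ f)%g \in D] (PSL2 O) ->
  exists N : nat, (1 < N)%N /\ forall y, O y -> exists h, (h ^ f)%g \in D /\
    poincare_extension (1 + N%:R * y * N%:R) (N%:R * y) N%:R 1 h.
Proof.
move=> fi; have D1 : 1%g \in [pred g | (g ^ f)%g \in D].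
  by rewrite inE conj1g gpred1.
have [I HI] := finite_index_power fi D1.
have O0 := ringint_nat R d 0; have O1 := ringint_nat R d 1.
(* The factor 2 ensures [N > 1] even when the factorial is 1, as reduction modulo [N * N] requires;
   it is absorbed into the two unipotent matrices. *)
exists (I`! * 2)%N; split; first by have := fact_gt0 I; lia.
move=> y Oy.
have det z : 1 * 1 - z * 0 = 1 :> R[i] by rewrite mulr0 subr0 mulr1.
have det' z : 1 * 1 - 0 * z = 1 :> R[i] by rewrite mul0r subr0 mulr1.
have [g Hg] := poincare_exists (det (2%:R * y)).
have [h Hh] := poincare_exists (det' 2%:R).
have gD : (g ^+ I`! ^ f)%g \in D.
  apply: (fact_power_in_finite_index HI) => n; apply/asboolP.
  exists 1, (n%:R * (2%:R * y)), 0, 1; split; last by split; [|exact: poincare_unipotentX].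
  by split => //; do ?apply: ringintM => //; exact: ringint_nat.
have hD : (h ^+ I`! ^ f)%g \in D.
  apply: (fact_power_in_finite_index HI) => n; apply/asboolP.
  exists 1, 0, (n%:R * 2%:R), 1; split; last by split; [|exact: poincare_unipotent_transposeX].
  by split => //; do ?apply: ringintM => //; exact: ringint_nat.
exists (g ^+ I`! * h ^+ I`!)%g; split; first by rewrite conjMg gpredM.
have := poincare_comp (det' _) (poincare_unipotentX I`! Hg)
          (poincare_unipotent_transposeX I`! Hh).
by rewrite !(mul1r, mulr0, mul0r, addr0, add0r, mulr1) natrM -(mulrA _ 2%:R y).
Qed.

(* The diagonal entries of an upper triangular element are units of [O], hence
   of modulus 1. *)
Lemma ringint_lower_left_neq0 a b c e : O a -> O e -> a * e - b * c = 1 ->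
  4 < nsq (a + e) -> c != 0.
Proof.
move=> Oa Oe det1; apply: contraTneq => c0.
move: det1; rewrite c0 mulr0 subr0 => ae1.
have a0 : a != 0 by apply: contra_eq_neq ae1 => ->; rewrite mul0r eq_sym oner_eq0.
have e0 : e != 0 by apply: contra_eq_neq ae1 => ->; rewrite mulr0 eq_sym oner_eq0.
have na := ringint_normc_ge1 Oa a0; have ne := ringint_normc_ge1 Oe e0.
have := congr1 (@Normc.normc R) ae1; rewrite Normc.normcM Normc.normc1 => n1.
have := le_normcD a e; have := normc_ge0 (a + e); rewrite -leNgt.
move: (Normc.normc _) (Normc.normc _) (Normc.normc _) na ne n1 => x y z.
by move=> *; nra.
Qed.

Lemma trace_congruence g (m : nat) : (1 < m)%N -> g \in PSL2 O ->
  exists2 n0, (0 < n0)%N & forall q, exists a b c e y,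
    [/\ O a, O e & O y] /\ [/\ a * e - b * c = 1, a + e = 2 + m%:R * y &
    poincare_extension a b c e (g ^+ (n0 * q))%g].
Proof.
move=> m1 /PSL2P[a [b [c [e [[Oa Ob Oc Oe] [det1 Hg]]]]]].
have Ot := ringintD Oa Oe; have [n0 n00 per] := cheb_trace_period m1 Ot.
exists n0 => // q; have [y Oy yE] := per q.
have [det Hq] := poincareX (n0 * q) det1 Hg.
have Oq := ringint_cheb _ Ot.
do 4!eexists; exists y; split; last by split; [exact: det | rewrite cheb_trace | exact: Hq].
by split => //; apply: ringintB => //; apply: ringintM.
Qed.

(* The hypothesis on [L] is the negation of the bound of [cheb_root_bound]. *)
Lemma no_root_in_PSL2 a b e g h s (N : nat) L : (0 < N)%N -> (0 < s)%N ->
  a * e - b * N%:R = 1 -> poincare_extension a b N%:R e g -> translates g L ->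
  ((N%:R + 1) ^+ 2 + 1) ^+ 2 < cosh2 L - 2 ->
  h \in PSL2 O -> (h ^+ s)%g = g -> s = 1%N.
Proof.
move=> N0 s0 det1 Hg gL Llarge /PSL2P[a' [b' [c' [e' [[Oa Ob Oc Oe] [det1' Hh]]]]]] hs.
have [det Hs] := poincareX s det1' Hh; rewrite hs in Hs.
have [s1|//|//] := ltngtP 1 s; last by case: (s) s0.
(* Only moduli can be compared: [N] is the modulus of the Chebyshev factor times [|c'|], and
   [|c'| >= 1] since [c'] is a nonzero element of [O]. *)
have cN := poincare_lower_left Hs Hg; rewrite Normc.normcM in cN.
have NN : Normc.normc (N%:R : R[i]) = N%:R.
  by rewrite -(real_complex_nat R) /= expr0n addr0 sqrtr_sqr ger0_norm.
have c0 : c' != 0.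
  apply: contra_eq_neq cN => ->; rewrite Normc.normc0 mulr0 NN eq_sym pnatr_eq0.
  by rewrite -lt0n.
have c1 := ringint_normc_ge1 Oc c0.
have WN : Normc.normc (cheb (a' + e') s.+1) <= N%:R.
  by rewrite -NN -cN ler_peMr // normc_ge0.
have := trace_bound det Hs gL; rewrite cheb_trace => tL.
have := cheb_root_bound s1 (ler0n _ _) WN.
have := normc_ge0 (cheb (a' + e') s.+2 - cheb (a' + e') s).
move: (Normc.normc _) tL => x tL x0 xN.
have : x ^+ 2 <= ((N%:R + 1) ^+ 2 + 1) ^+ 2.
  by rewrite ler_pXn2r ?nnegrE // addr_ge0 ?sqr_ge0.
by move=> /(le_trans tL)/(lt_le_trans Llarge); rewrite ltxx.
Qed.

End Arithmetic.

(** * Primitive elements of [Gam] with bounded root exponent, and the progression *)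

Lemma eventually_bounded_root (R : realType) (d : nat) (Gam D : groupClosed (isom R))
    (f1 f2 g0 : isom R) (l : R) :
  finite_index [pred g | (g ^ f1)%g \in D] Gam ->
  finite_index [pred g | (g ^ f2)%g \in D]
    (PSL2 (ring_of_integers (imag_quadratic_field (R := R) d))) ->
  g0 \in Gam -> translates g0 l ->
  exists K I q1 : nat, (0 < K)%N /\ forall q, (q1 <= q)%N -> exists h s,
    [/\ primitive_elt Gam h, (0 < s)%N, (s <= I)%N &
        translates h ((q * K)%:R * l / s%:R)].
Proof.
move=> fi1 fi2 g0G g0l; have [l0 _] := g0l.
have [I HI] : exists I : nat, forall g, g \in Gam -> exists j,
    [/\ (0 < j)%N, (j <= I)%N & (g ^+ j ^ f1)%g \in D].
  have D1 : 1%g \in [pred g | (g ^ f1)%g \in D] by rewrite inE conj1g gpred1.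
  have [I HI] := finite_index_power fi1 D1; exists I => g gG.
  by apply: HI => n; exact: gpredXn.
(* Conjugation by [P] goes from [Gam] to [PSL2 O] through their common subgroup: [(g ^ P) ^ f2] is
   [g ^ f1]. *)
pose P := (f1 * f2^-1)%g.
have toPSL2 g : (g ^ f1)%g \in D -> (g ^ P)%g \in PSL2
    (ring_of_integers (imag_quadratic_field (R := R) d)).
  by move=> gD; apply: fi2.1; rewrite inE conjgM conjgKV.
have [j0 [j00 _ /toPSL2 gPSL]] := HI _ g0G; set g := (_ ^ P)%g in gPSL.
have gl : translates g (j0%:R * l) by exact/translatesJ/translatesX.
have [N [N1 HN]] := unipotent_products fi2.
have N0 : (N%:R : R[i]) != 0 by rewrite pnatr_eq0 -lt0n ltnW.
have [|n0 n00 Hn] := trace_congruence (m := (N * N)%N) _ gPSL; first by nia.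
(* Large enough for both uses: the bound of [no_root_in_PSL2] and the trace condition
   [4 < nsq (a + e)]. *)
pose B : R := ((N%:R + 1) ^+ 2 + 1) ^+ 2 + 4.
have B0 : 0 <= B by rewrite addr_ge0 ?sqr_ge0.
(* [j0] moves [g0] into [PSL2 O], [n0] is the period of the traces modulo [N * N], and the last
   bound forces [L > B + 1]. *)
exists (n0 * j0)%N, I, (Num.bound ((B + 1) / l)); split; first by rewrite muln_gt0 n00.
move=> q q1q; set L := (q * (n0 * j0))%:R * l.
have BL : B + 1 < L.
  have Bl : 0 <= (B + 1) / l by rewrite divr_ge0 ?ltW // ltr_wpDl.
  rewrite -ltr_pdivrMr //; apply: lt_le_trans (archi_boundP Bl) _.
  by rewrite ler_nat (leq_trans q1q) // leq_pmulr // muln_gt0 n00.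
have LB : B < cosh2 L - 2.
  rewrite ltrBrDr; have -> : B + 2 = 1 + (B + 1) by ring.
  apply: (@lt_le_trans _ _ (1 + L)); first by rewrite ltrD2l.
  by apply: le_trans (expR_ge1Dx L) _; rewrite lerDl expR_ge0.
have q0 : (0 < q)%N.
  rewrite lt0n; apply: contraTneq BL => q0.
  by rewrite /L q0 mul0n mul0r -leNgt addr_ge0.
have [a [b [c [e [y [[Oa Oe Oy] [det1 tr Hq]]]]]]] := Hn q.
have qL : translates (g ^+ (n0 * q))%g L.
  have -> : L = (n0 * q)%:R * (j0%:R * l) by rewrite /L !natrM; ring.
  by apply: translatesX => //; rewrite muln_gt0 n00.
have tr4 : 4 < nsq (a + e).
  apply: lt_le_trans (trace_bound det1 Hq qL); apply: le_lt_trans LB.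
  by rewrite lerDr sqr_ge0.
have c0 := ringint_lower_left_neq0 Oa Oe det1 tr4.
have [h [hD Hh]] := HN y Oy.
have deth : (1 + N%:R * y * N%:R) * 1 - N%:R * y * N%:R = 1 by ring.
have trh : a + e = 1 + N%:R * y * N%:R + 1 by rewrite tr natrM; ring.
have hL := translates_same_trace det1 deth c0 N0 trh tr4 Hq Hh qL.
pose eta := (h ^ P^-1)%g; have etaP : (eta ^ P)%g = h by rewrite /eta conjgKV.
have etaD : (eta ^ f1)%g \in D by rewrite /eta invgM invgK conjgM conjgKV.
have etaG : eta \in Gam by exact: fi1.1.
(* If [x ^+ s = eta], the least [j] bringing [x] into the common subgroup divides [s]. Then [x ^+ j]
   is carried by [P] to a root of [h] in [PSL2 O] of exponent [s / j], which must be 1; so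
   [s = j <= I]. *)
have bnd x s : x \in Gam -> (0 < s)%N -> (x ^+ s)%g = eta -> (s <= I)%N.
  move=> xG s0 xs; have [j1 [j10 j1I xj1]] := HI x xG.
  have exj : exists j, (0 < j)%N && ((x ^+ j ^ f1)%g \in D).
    by exists j1; rewrite j10.
  case: (ex_minnP exj) => j /andP[jpos xj] jmin.
  have jI : (j <= I)%N by apply: leq_trans j1I; apply: jmin; rewrite j10.
  have : (j %| s)%N.
    apply: (@power_order_dvd _ D (x ^ f1)%g); rewrite -?conjXg ?xs //.
    by move=> i i0 xi; apply: jmin; rewrite i0 conjXg.
  move=> /dvdnP[k sk]; rewrite sk in s0 xs *.
  suff -> : k = 1%N by rewrite mul1n.
  apply: (no_root_in_PSL2 (ltnW N1) _ deth Hh hL _ (toPSL2 _ xj)).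
  - by move: s0; rewrite muln_gt0 => /andP[].
  - by apply: le_lt_trans LB; rewrite lerDl.
  - by rewrite -conjXg -expgnA mulnC xs.
have [x [s [xprim s0 sI xs]]] := maximal_root etaG bnd.
exists x, s; split=> //.
rewrite -(conjgK P x); apply: translatesJ.
by apply: (root_translates deth N0 _ Hh hL s0); rewrite -?trh // -conjXg xs.
Qed.

Theorem theorem1p6 (R : realType) (Gam : groupClosed (isom R))
  (Gam_manifold : is_hyperbolic_manifold_group Gam)
  (Gam_arithmetic : noncompact_arithmetic Gam) :
  forall l : R, in_multiset (primitive_length_spectrum Gam) l ->
  forall k : nat,
  exists2 x : 'I_k -> R,
    arithmetic_progression_in (primitive_length_spectrum Gam) x &
    forall j : 'I_k, exists m : int, x j = m%:~R * l.
Proof.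
move=> l /spectrum_translates[g gG gl] k; have [l0 _] := gl.
have [_ [d _ [D [[f1 fi1] [f2 fi2]]]]] := Gam_arithmetic.
have [K [I [q1 [K0 HK]]]] := eventually_bounded_root fi1 fi2 gG gl.
(* The factorial makes division by any [s <= I] exact, and adding [q1] passes the threshold of
   [HK]. *)
pose q n := (I`! * (q1 + n))%N.
have /choice[s sP] : forall n, exists s, [/\ (0 < s)%N, (s <= I)%N &
    exists2 h, primitive_elt Gam h & translates h ((q n * K)%:R * l / s%:R)].
  move=> n; have [|h [s [hprim s0 sI hL]]] := HK (q n); last by exists s; split=> //; exists h.
  by apply: leq_trans (leq_addr n q1) _; rewrite leq_pmull ?fact_gt0.
have [W HW] := van_der_Waerden k 'I_I.+1.
have [a [e [e0 _ col]]] := HW (fun n => inord (s n)).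
have sconst j : (0 < j <= k)%N -> s (a + j * e)%N = s (a + e)%N.
  move=> /col/(congr1 val); have [_ s1 _] := sP (a + j * e)%N.
  by have [_ s2 _] := sP (a + e)%N; rewrite /= !inordK.
move: (s (a + e)%N) sconst (sP (a + e)%N) => s1 sconst [s10 s1I _].
have s1dvd : (s1 %| I`!)%N by rewrite dvdn_fact ?s10.
pose M := (I`! %/ s1 * K)%N; have M0 : (0 < M)%N.
  by rewrite muln_gt0 K0 divn_gt0 // dvdn_leq ?fact_gt0.
(* Terms start at [j.+1] because the base point [a] may have another colour; [M] is the integer
   factor left after division by the constant exponent [s1]. *)
exists (fun j => (M * (q1 + (a + j.+1 * e)))%:R * l); last first.
  by move=> j; exists (M * (q1 + (a + j.+1 * e)))%N%:Z.
split=> [i j ij||j].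
- by rewrite ltr_pM2r // ltr_nat ltn_pmul2l // !ltn_add2l ltn_pmul2r.
- exists ((M * e)%:R * l), ((M * (q1 + a))%:R * l) => j.
  by rewrite !(natrM, natrD); ring.
have jk : (0 < j.+1 <= k)%N by rewrite ltn_ord.
have [_ _ [h hprim]] := sP (a + j.+1 * e)%N; rewrite (sconst _ jk) => hL.
apply: (translates_spectrum hprim); move: hL; congr translates.
have s1R : s1%:R != 0 :> R by rewrite pnatr_eq0 -lt0n.
apply: (mulIf s1R); rewrite mulfVK // mulrAC -natrM; congr (_%:R * _).
by rewrite /q /M -{1}(divnK s1dvd); ring.
Qed.
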